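(* Let $n\ge 4$ be an integer. For every symmetric bipartition $\lambda=(\lambda^1,\lambda^2)$ of $n$ (that is, $\lambda^1=\lambda^2$) and every parameter $c\in\mathbb{C}$, the irreducible representations $L_c(\lambda^+)$ and $L_c(\lambda^-)$ of the rational Cherednik algebra $H_c(D_n,\mathbb{C}^n)$ are infinite-dimensional over $\mathbb{C}$.
   Context: Rational Cherednik algebra: let $W$ be a finite complex reflection group with reflection representation $\mathfrak{h}$, $S\subset W$ its set of reflections, and $c:S\to\mathbb{C}$ a $W$-invariant function. For $s\in S$ let $\alpha_s\in\mathfrak{h}^*$ be an eigenvector of $s$ with eigenvalue $\lambda_s\ne 1$ and $\alpha_s^\vee\in\mathfrak{h}$ an eigenvector of $s$ with eigenvalue $\lambda_s^{-1}$, normalized so that $\langle\alpha_s,\alpha_s^\vee\rangle=2$. Then $H_c(W,\mathfrak{h})$ is the quotient of $\mathbb{C}W\ltimes T(\mathfrak{h}^*\oplus\mathfrak{h})$ by the relations $[x,x']=[y,y']=0$ and $[y,x]=\langle y,x\rangle-\sum_{s\in S}c_s\langle\alpha_s,y\rangle\langle x,\alpha_s^\vee\rangle s$ for all $x,x'\in\mathfrak{h}^*$, $y,y'\in\mathfrak{h}$. Irreducibles: for an irreducible complex representation $V$ of $W$, extend the $W$-action on $V$ to $\mathbb{C}[\mathfrak{h}^*]\rtimes\mathbb{C}W$ by letting $\mathfrak{h}\subset\mathbb{C}[\mathfrak{h}^*]$ act by $0$. The standard module is $\Delta_c(V)=H_c(W,\mathfrak{h})\otimes_{\mathbb{C}[\mathfrak{h}^*]\rtimes\mathbb{C}W}V$;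 it has a unique irreducible quotient, denoted $L_c(V)$. Types $B$ and $D$: $B_n=S_n\ltimes(\mathbb{Z}/2\mathbb{Z})^n$ acts on $\mathbb{C}^n$ by permutations and sign changes of the coordinates, and $D_n\subset B_n$ is the index $2$ subgroup of elements with an even number of sign changes, generated by the reflections in the hyperplanes $z_i=\pm z_j$. These form one conjugacy class, so a parameter for $H_c(D_n,\mathbb{C}^n)$ is identified with a complex number $c$ (the value on these reflections). A bipartition of $n$ is an ordered pair $\lambda=(\lambda^1,\lambda^2)$ of partitions with $|\lambda^1|+|\lambda^2|=n$. The irreducible complex representations $V_\lambda$ of $B_n$ are labeled by bipartitions of $n$ in the standard way: $V_{(\lambda^1,\lambda^2)}$ is induced from $B_{|\lambda^1|}\times B_{|\lambda^2|}$ from the outer tensor product of the irreducible $S_{|\lambda^1|}$-representation labeled by $\lambda^1$ (inflated to $B_{|\lambda^1|}$) and the irreducible $S_{|\lambda^2|}$-representation labeled by $\lambda^2$ (inflated to $B_{|\lambda^2|}$) twisted by the character that is trivial on the symmetric group and equals $-1$ on each single sign change. When $\lambda$ is symmetric, the restriction of $V_\lambda$ to $D_n$ is a direct sum of two non-isomorphic irreducible representations, denoted $V_\lambda^+$ and $V_\lambda^-$, and $L_c(\lambda^\pm):=L_c(V_\lambda^\pm)$. *)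

(* Defs.v *)
From HB Require Import structures.
From mathcomp Require Import all_boot all_order all_fingroup all_algebra.
From mathcomp Require Import mxrepresentation character.
From mathcomp Require Import generic_quotient.
From mathcomp Require Import boolp reals complex.

Set Implicit Arguments.
Unset Strict Implicit.
Unset Printing Implicit Defensive.

Import GroupScope GRing.Theory.
Local Open Scope ring_scope.
Local Open Scope quotient_scope.

(* An mx_representation acts on row vectors from the right. Throughout, rV
   carries the left action w . v := v *m rV w^-1, so that left submodules are
   exactly the row spaces stable under rV. The reflection representation h is the
   space of row vectors, its dual h^* the space of column vectors with the
   contragredient action w . x := rH w *m x. *)

Definition pairing (F : fieldType) n (y : 'rV[F]_n) (x : 'cV[F]_n) : F :=
  (y *m x) 0 0.

Definition is_reflection (F : fieldType) (gT : finGroupType) (W : {group gT}) n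
    (rH : mx_representation F W n) (s : gT) : bool :=
  (s \in W) && (\rank (rH s - 1%:M)%R == 1)%N.

Definition root_choice (F : fieldType) (gT : finGroupType) (W : {group gT}) n
    (rH : mx_representation F W n)
    (alpha : gT -> 'cV[F]_n) (alphav : gT -> 'rV[F]_n) : Prop :=
  forall s, is_reflection rH s ->
    exists2 lambda : F, lambda != 1 &
      [/\ rH s *m alpha s = lambda *: alpha s,
          alphav s *m rH s^-1%g = lambda^-1 *: alphav s
        & pairing (alphav s) (alpha s) = 2%:R].

Section Cherednik.

Variables (F : fieldType) (gT : finGroupType) (W : {group gT}) (n : nat).
Variables (rH : mx_representation F W n) (c : gT -> F).
Variables (alpha : gT -> 'cV[F]_n) (alphav : gT -> 'rV[F]_n).

(* H_c(W, h) is the quotient of the formal expressions in scalars, group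
   elements, h^* and h by the congruence generated by the axioms of an
   associative unital F-algebra, the relations of FW |x T(h^* + h), and the
   commutation relations of the rational Cherednik algebra. *)
Inductive cher_term : Type :=
| Scal of F
| Grp of subg_of W
| Pos of 'cV[F]_n
| Mom of 'rV[F]_n
| Add of cher_term & cher_term
| Mul of cher_term & cher_term.

Definition Sub t u := Add t (Mul (Scal (-1)) u).

Definition cher_comm (y : 'rV[F]_n) (x : 'cV[F]_n) : cher_term :=
  Sub (Scal (pairing y x))
    (\big[Add/Scal 0]_(s : subg_of W | is_reflection rH (sgval s))
       Mul (Scal (c (sgval s) * pairing y (alpha (sgval s))
                              * pairing (alphav (sgval s)) x)) (Grp s)).

Inductive cher_eq : cher_term -> cher_term -> Prop :=
| ce_refl t : cher_eq t t
| ce_sym t u : cher_eq t u -> cher_eq u t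
| ce_trans t u v : cher_eq t u -> cher_eq u v -> cher_eq t v
| ce_add t t' u u' : cher_eq t t' -> cher_eq u u' ->
    cher_eq (Add t u) (Add t' u')
| ce_mul t t' u u' : cher_eq t t' -> cher_eq u u' ->
    cher_eq (Mul t u) (Mul t' u')
| ce_addA t u v : cher_eq (Add t (Add u v)) (Add (Add t u) v)
| ce_addC t u : cher_eq (Add t u) (Add u t)
| ce_add0 t : cher_eq (Add (Scal 0) t) t
| ce_mulA t u v : cher_eq (Mul t (Mul u v)) (Mul (Mul t u) v)
| ce_mul1 t : cher_eq (Mul (Scal 1) t) t
| ce_mul0 t : cher_eq (Mul (Scal 0) t) (Scal 0)
| ce_mulDl t u v : cher_eq (Mul (Add t u) v) (Add (Mul t v) (Mul u v))
| ce_mulDr t u v : cher_eq (Mul t (Add u v)) (Add (Mul t u) (Mul t v))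
| ce_scalD a b : cher_eq (Scal (a + b)) (Add (Scal a) (Scal b))
| ce_scalM a b : cher_eq (Scal (a * b)) (Mul (Scal a) (Scal b))
| ce_scalC a t : cher_eq (Mul (Scal a) t) (Mul t (Scal a))
| ce_grp1 : cher_eq (Grp 1%g) (Scal 1)
| ce_grpM w w' : cher_eq (Grp (w * w')%g) (Mul (Grp w) (Grp w'))
| ce_posL a x x' : cher_eq (Pos (a *: x + x')) (Add (Mul (Scal a) (Pos x)) (Pos x'))
| ce_momL a y y' : cher_eq (Mom (a *: y + y')) (Add (Mul (Scal a) (Mom y)) (Mom y'))
| ce_grp_pos w x :
    cher_eq (Mul (Grp w) (Pos x)) (Mul (Pos (rH (sgval w) *m x)) (Grp w))
| ce_grp_mom w y :
    cher_eq (Mul (Grp w) (Mom y)) (Mul (Mom (y *m rH (sgval w)^-1%g)) (Grp w))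
| ce_posC x x' : cher_eq (Mul (Pos x) (Pos x')) (Mul (Pos x') (Pos x))
| ce_momC y y' : cher_eq (Mul (Mom y) (Mom y')) (Mul (Mom y') (Mom y))
| ce_mom_pos y x :
    cher_eq (Sub (Mul (Mom y) (Pos x)) (Mul (Pos x) (Mom y))) (cher_comm y x).

HB.instance Definition _ := gen_eqMixin cher_term.
HB.instance Definition _ := gen_choiceMixin cher_term.

Definition cher_eqb (t u : cher_term) : bool := `[< cher_eq t u >].

Lemma cher_eqb_refl : reflexive cher_eqb.
Proof. by move=> t; apply/asboolP; apply: ce_refl. Qed.

Lemma cher_eqb_sym : symmetric cher_eqb.
Proof. by move=> t u; apply/asboolP/asboolP => /ce_sym. Qed.

Lemma cher_eqb_trans : transitive cher_eqb.
Proof.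
move=> u t v /asboolP tu /asboolP uv; apply/asboolP; exact: ce_trans tu uv.
Qed.

Canonical cher_equiv :=
  EquivRel cher_eqb cher_eqb_refl cher_eqb_sym cher_eqb_trans.

Definition cherednik := {eq_quot cher_equiv}.
HB.instance Definition _ := Choice.on cherednik.
HB.instance Definition _ := EqQuotient.on cherednik.

Definition cher_of (t : cher_term) : cherednik := \pi_cherednik t.

Lemma cher_ofP t u : cher_of t = cher_of u <-> cher_eq t u.
Proof. by split=> [/eqquotP/asboolP|tu] //; apply/eqquotP/asboolP. Qed.

Lemma cher_of_surj (h : cherednik) : exists t, h = cher_of t.
Proof. by exists (repr h); rewrite /cher_of reprK. Qed.

Definition cher_add (g h : cherednik) := cher_of (Add (repr g) (repr h)).
Definition cher_mul (g h : cherednik) := cher_of (Mul (repr g) (repr h)).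
Definition cher_opp (h : cherednik) := cher_of (Mul (Scal (-1)) (repr h)).

Lemma cher_eq_repr t : cher_eq (repr (cher_of t)) t.
Proof. by apply/cher_ofP; rewrite /cher_of reprK. Qed.

Lemma cher_addE t u : cher_add (cher_of t) (cher_of u) = cher_of (Add t u).
Proof. by apply/cher_ofP/ce_add; apply: cher_eq_repr. Qed.

Lemma cher_mulE t u : cher_mul (cher_of t) (cher_of u) = cher_of (Mul t u).
Proof. by apply/cher_ofP/ce_mul; apply: cher_eq_repr. Qed.

Lemma cher_oppE t : cher_opp (cher_of t) = cher_of (Mul (Scal (-1)) t).
Proof.
by apply/cher_ofP/ce_mul; [apply: ce_refl | apply: cher_eq_repr].
Qed.

Lemma cher_addA : associative cher_add.
Proof.
move=> f g h; have [[t ->] [u ->] [v ->]] :=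
  And3 (cher_of_surj f) (cher_of_surj g) (cher_of_surj h).
by rewrite !cher_addE; apply/cher_ofP/ce_addA.
Qed.

Lemma cher_addC : commutative cher_add.
Proof.
move=> f g; have [[t ->] [u ->]] := conj (cher_of_surj f) (cher_of_surj g).
by rewrite !cher_addE; apply/cher_ofP/ce_addC.
Qed.

Lemma cher_add0 : left_id (cher_of (Scal 0)) cher_add.
Proof.
by move=> f; have [t ->] := cher_of_surj f; rewrite cher_addE;
  apply/cher_ofP/ce_add0.
Qed.

Lemma cher_addN : left_inverse (cher_of (Scal 0)) cher_opp cher_add.
Proof.
move=> f; have [t ->] := cher_of_surj f; rewrite cher_oppE cher_addE.
apply/cher_ofP; rewrite -(addNr (1 : F)).
apply: ce_trans (ce_add (ce_refl _) (ce_sym (ce_mul1 t))) _.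
apply: ce_trans (ce_sym (ce_mulDl _ _ _)) _.
apply: ce_trans (ce_mul (ce_sym (ce_scalD _ _)) (ce_refl _)) _.
by rewrite addNr; apply: ce_mul0.
Qed.

Lemma cher_mulA : associative cher_mul.
Proof.
move=> f g h; have [[t ->] [u ->] [v ->]] :=
  And3 (cher_of_surj f) (cher_of_surj g) (cher_of_surj h).
by rewrite !cher_mulE; apply/cher_ofP/ce_mulA.
Qed.

Lemma cher_mul1l : left_id (cher_of (Scal 1)) cher_mul.
Proof.
by move=> f; have [t ->] := cher_of_surj f; rewrite cher_mulE;
  apply/cher_ofP/ce_mul1.
Qed.

Lemma cher_mul1r : right_id (cher_of (Scal 1)) cher_mul.
Proof.
move=> f; have [t ->] := cher_of_surj f; rewrite cher_mulE.
by apply/cher_ofP; apply: ce_trans (ce_sym (ce_scalC _ _)) (ce_mul1 _).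
Qed.

Lemma cher_mulDl : left_distributive cher_mul cher_add.
Proof.
move=> f g h; have [[t ->] [u ->] [v ->]] :=
  And3 (cher_of_surj f) (cher_of_surj g) (cher_of_surj h).
by rewrite !(cher_addE, cher_mulE); apply/cher_ofP/ce_mulDl.
Qed.

Lemma cher_mulDr : right_distributive cher_mul cher_add.
Proof.
move=> f g h; have [[t ->] [u ->] [v ->]] :=
  And3 (cher_of_surj f) (cher_of_surj g) (cher_of_surj h).
by rewrite !(cher_addE, cher_mulE); apply/cher_ofP/ce_mulDr.
Qed.

(* 1 != 0 is a consequence of the PBW theorem, hence only a pzRingType *)
HB.instance Definition _ := GRing.isPzRing.Build cherednik
  cher_addA cher_addC cher_add0 cher_addN
  cher_mulA cher_mul1l cher_mul1r cher_mulDl cher_mulDr.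

Definition cher_scal (a : F) : cherednik := cher_of (Scal a).
Definition cher_grp (w : subg_of W) : cherednik := cher_of (Grp w).
Definition cher_pos (x : 'cV[F]_n) : cherednik := cher_of (Pos x).
Definition cher_mom (y : 'rV[F]_n) : cherednik := cher_of (Mom y).

End Cherednik.

Section QuotientModule.

Variables (A : pzRingType) (M : lmodType A) (X : M -> Prop).

Inductive submod_gen : M -> Prop :=
| sg_gen u : X u -> submod_gen u
| sg_zero : submod_gen 0
| sg_lin a u v : submod_gen u -> submod_gen v -> submod_gen (a *: u + v).

Definition submod_eqb (u v : M) : bool := `[< submod_gen (u - v) >].

Lemma submod_gen_scale a u : submod_gen u -> submod_gen (a *: u).
Proof. by move=> Xu; rewrite -[_ *: _]addr0; apply: sg_lin Xu sg_zero. Qed.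

Lemma submod_gen_add u v : submod_gen u -> submod_gen v -> submod_gen (u + v).
Proof. by move=> Xu Xv; rewrite -[u]scale1r; apply: sg_lin. Qed.

Lemma submod_eqb_refl : reflexive submod_eqb.
Proof. by move=> u; apply/asboolP; rewrite subrr; apply: sg_zero. Qed.

Lemma submod_eqb_sym : symmetric submod_eqb.
Proof.
suff S u v : submod_gen (u - v) -> submod_gen (v - u).
  by move=> u v; apply/asboolP/asboolP; apply: S.
by move/(submod_gen_scale (-1)); rewrite scaleN1r opprB.
Qed.

Lemma submod_eqb_trans : transitive submod_eqb.
Proof.
move=> v u w /asboolP uv /asboolP vw; apply/asboolP.
by rewrite -(subrKA v); apply: submod_gen_add.
Qed.

Canonical submod_equiv :=
  EquivRel submod_eqb submod_eqb_refl submod_eqb_sym submod_eqb_trans.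

Definition quot_module := {eq_quot submod_equiv}.
HB.instance Definition _ := Choice.on quot_module.
HB.instance Definition _ := EqQuotient.on quot_module.

Definition quot_of (u : M) : quot_module := \pi_quot_module u.

Lemma quot_ofP u v : quot_of u = quot_of v <-> submod_gen (u - v).
Proof. by split=> [/eqquotP/asboolP|uv] //; apply/eqquotP/asboolP. Qed.

Lemma quot_of_surj (q : quot_module) : exists u, q = quot_of u.
Proof. by exists (repr q); rewrite /quot_of reprK. Qed.

Definition quot_add (p q : quot_module) := quot_of (repr p + repr q).
Definition quot_opp (q : quot_module) := quot_of (- repr q).
Definition quot_scale (a : A) (q : quot_module) := quot_of (a *: repr q).

Lemma quot_repr u : submod_gen (repr (quot_of u) - u).
Proof. by apply/quot_ofP; rewrite /quot_of reprK. Qed.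

Lemma quot_addE u v : quot_add (quot_of u) (quot_of v) = quot_of (u + v).
Proof.
by apply/quot_ofP; rewrite opprD addrACA; apply: submod_gen_add; apply: quot_repr.
Qed.

Lemma quot_scaleE a u : quot_scale a (quot_of u) = quot_of (a *: u).
Proof.
by apply/quot_ofP; rewrite -scalerBr; apply: submod_gen_scale; apply: quot_repr.
Qed.

Lemma quot_oppE u : quot_opp (quot_of u) = quot_of (- u).
Proof.
apply/quot_ofP; rewrite -opprD.
by have := submod_gen_scale (-1) (quot_repr u); rewrite scaleN1r.
Qed.

Lemma quot_addA : associative quot_add.
Proof.
move=> p q r; have [[u ->] [v ->] [w ->]] :=
  And3 (quot_of_surj p) (quot_of_surj q) (quot_of_surj r).
by rewrite !quot_addE addrA.
Qed.

Lemma quot_addC : commutative quot_add.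
Proof.
move=> p q; have [[u ->] [v ->]] := conj (quot_of_surj p) (quot_of_surj q).
by rewrite !quot_addE addrC.
Qed.

Lemma quot_add0 : left_id (quot_of 0) quot_add.
Proof. by move=> p; have [u ->] := quot_of_surj p; rewrite quot_addE add0r. Qed.

Lemma quot_addN : left_inverse (quot_of 0) quot_opp quot_add.
Proof.
by move=> p; have [u ->] := quot_of_surj p; rewrite quot_oppE quot_addE addNr.
Qed.

HB.instance Definition _ := GRing.isZmodule.Build quot_module
  quot_addA quot_addC quot_add0 quot_addN.

Lemma quot_scaleA a b q : quot_scale a (quot_scale b q) = quot_scale (a * b) q.
Proof. by have [u ->] := quot_of_surj q; rewrite !quot_scaleE scalerA. Qed.

Lemma quot_scale1 : left_id 1 quot_scale.
Proof. by move=> q; have [u ->] := quot_of_surj q; rewrite quot_scaleE scale1r. Qed.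

Lemma quot_scaleDr : right_distributive quot_scale +%R.
Proof.
move=> a p q; have [[u ->] [v ->]] := conj (quot_of_surj p) (quot_of_surj q).
by rewrite [_ + _]quot_addE !quot_scaleE [RHS]quot_addE scalerDr.
Qed.

Lemma quot_scaleDl q : {morph quot_scale^~ q : a b / a + b}.
Proof.
move=> a b; have [u ->] := quot_of_surj q.
by rewrite /= !quot_scaleE [RHS]quot_addE scalerDl.
Qed.

HB.instance Definition _ := GRing.Zmodule_isLmodule.Build A quot_module
  quot_scaleA quot_scale1 quot_scaleDr quot_scaleDl.

End QuotientModule.

Definition simple_module (A : pzRingType) (M : lmodType A) : Prop :=
  (exists v : M, v != 0) /\
  (forall N : {pred M}, GRing.submod_closed N ->
     {in N, forall v, v = 0} \/ (forall v, v \in N)).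

Definition irreducible_quotient (A : pzRingType) (M L : lmodType A) : Prop :=
  simple_module L /\
  exists f : {linear M -> L}, forall v, exists u, f u = v.

Section StandardModule.

Variables (F : fieldType) (gT : finGroupType) (W : {group gT}) (n : nat).
Variables (rH : mx_representation F W n) (c : gT -> F).
Variables (alpha : gT -> 'cV[F]_n) (alphav : gT -> 'rV[F]_n).

Local Notation H := (cherednik rH c alpha alphav).

Section Standard.

Variables (d : nat) (rV : mx_representation F W d).

(* H (x)_F V is realised as 'rV[H]_d, with 1 (x) v the row below; tensoring over
   F[h^*] |x FW divides by the H-submodule generated by a (x) v - 1 (x) a v, where
   it is enough to let a range over the algebra generators of F[h^*] |x FW. *)
Definition one_tensor (v : 'rV[F]_d) : 'rV[H]_d :=
  map_mx (@cher_scal F gT W n rH c alpha alphav) v.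

Variant standard_rel : 'rV[H]_d -> Prop :=
| sr_mom y v : standard_rel (cher_mom rH c alpha alphav y *: one_tensor v)
| sr_grp (w : subg_of W) v :
    standard_rel (cher_grp rH c alpha alphav w *: one_tensor v
                  - one_tensor (v *m rV (sgval w)^-1%g)).

Definition standard_module : lmodType H := quot_module standard_rel.

End Standard.

(* the irreducible quotient is unique, so L is L_c(V) up to isomorphism *)
Definition is_Lc d (rV : mx_representation F W d) (L : lmodType H) : Prop :=
  irreducible_quotient (standard_module rV) L.

Definition finite_dimensional (L : lmodType H) : Prop :=
  exists (m : nat) (b : 'I_m -> L), forall v : L, exists a : 'I_m -> F,
    v = \sum_(i < m) cher_scal rH c alpha alphav (a i) *: b i.

End StandardModule.

Section SignedPerm.

Variable n : nat.

(* (s, e) sends the basis row e_i to (-1) ^ (e i) e_(s i), acting from the right *)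
Definition signed_perm : Type := ('S_n * {ffun 'I_n -> bool})%type.
HB.instance Definition _ := Finite.on signed_perm.

Definition sp_mul (g h : signed_perm) : signed_perm :=
  ((g.1 * h.1)%g, [ffun i => g.2 i (+) h.2 (g.1 i)]).
Definition sp_one : signed_perm := (1%g, [ffun=> false]).
Definition sp_inv (g : signed_perm) : signed_perm :=
  ((g.1^-1)%g, [ffun i => g.2 ((g.1^-1)%g i)]).

Lemma sp_mulA : associative sp_mul.
Proof.
move=> f g h; congr (_, _); first exact: mulgA.
by apply/ffunP=> i; rewrite !ffunE /= permM addbA.
Qed.

Lemma sp_mul1 : left_id sp_one sp_mul.
Proof.
case=> s e; congr (_, _); first exact: mul1g.
by apply/ffunP=> i; rewrite !ffunE perm1.
Qed.

Lemma sp_mulV : left_inverse sp_one sp_inv sp_mul.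
Proof.
case=> s e; congr (_, _); first exact: mulVg.
by apply/ffunP=> i; rewrite !ffunE addbb.
Qed.

HB.instance Definition _ :=
  Finite_isGroup.Build signed_perm sp_mulA sp_mul1 sp_mulV.

Definition sign_changes (g : signed_perm) : nat := #|[set i | g.2 i]|.

Lemma odd_sign_changesM (g h : signed_perm) :
  odd (sign_changes (g * h)%g) = odd (sign_changes g) (+) odd (sign_changes h).
Proof.
have E (f : signed_perm) : odd (sign_changes f) = \big[addb/false]_i f.2 i.
  rewrite /sign_changes -sum1_card (big_morph odd oddD (erefl _)) big_mkcond.
  by apply: eq_bigr => i _; rewrite inE; case: (f.2 i).
rewrite !E [X in _ (+) X](reindex_inj (@perm_inj _ g.1)) -big_split /=.
by apply: eq_bigr => i _; rewrite ffunE.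
Qed.

Lemma sign_changes1 : sign_changes 1%g = 0%N.
Proof. by apply: eq_card0 => i; rewrite !inE ffunE. Qed.

Definition Bn : {group signed_perm} := [set: signed_perm]%G.

Definition even_signed : {set signed_perm} := [set g | ~~ odd (sign_changes g)].

Lemma even_signed_group : group_set even_signed.
Proof.
apply/group_setP; split=> [|g h]; first by rewrite inE sign_changes1.
by rewrite !inE odd_sign_changesM => /negbTE-> /negbTE->.
Qed.

Definition Dn : {group signed_perm} := Group even_signed_group.

Variable F : fieldType.

Definition sp_mx (g : signed_perm) : 'M[F]_n :=
  \matrix_(i, j) ((-1) ^+ g.2 i * (g.1 i == j)%:R).

Lemma sp_mx_repr : mx_repr Bn sp_mx.
Proof.
split=> [|g h _ _]; apply/matrixP=> i j; rewrite !mxE.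
  by rewrite ffunE perm1 mul1r.
rewrite (bigD1 (g.1 i)) //= big1 => [|k /negbTE ki].
  by rewrite !mxE eqxx mulr1 addr0 ffunE permM mulrA signr_addb.
by rewrite !mxE eq_sym ki mulr0 mul0r.
Qed.

Definition Bn_refl : mx_representation F Bn n := MxRepresentation sp_mx_repr.
Definition Dn_refl : mx_representation F Dn n := subg_repr Bn_refl (subsetT Dn).

End SignedPerm.

Definition is_partition (la : seq nat) : bool := sorted geq la && (0%N \notin la).

Definition bipartition (n : nat) (la : seq nat * seq nat) : bool :=
  [&& is_partition la.1, is_partition la.2 & (sumn la.1 + sumn la.2 == n)%N].

Section Specht.

Variables (F : fieldType) (la : seq nat).
Local Notation m := (sumn la).

(* The canonical tableau of shape la puts i in row reshape_index la i and column
   reshape_offset la i. *)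
Definition row_stab : {set 'S_m} :=
  [set p : 'S_m | [forall i, reshape_index la (p i) == reshape_index la i]].
Definition col_stab : {set 'S_m} :=
  [set q : 'S_m | [forall i, reshape_offset la (q i) == reshape_offset la i]].

Definition young_symmetrizer : 'rV[F]_#|[set: 'S_m]| :=
  \sum_(p in row_stab) \sum_(q in col_stab)
    (-1) ^+ q *: delta_mx 0 (gring_index [set: 'S_m]%G (p * q)%g).

(* the S_m-module generated by the Young symmetrizer; la = [:: m] is the trivial
   representation *)
Definition specht :=
  submod_repr (cyclic_mx_module (regular_repr F [set: 'S_m]%G) young_symmetrizer).

End Specht.

Section Bipartition.

Variables (F : fieldType) (la : seq nat * seq nat).
Local Notation n1 := (sumn la.1).
Local Notation n2 := (sumn la.2).

(* S^la.1 (x) (S^la.2 (x) sign-change character), inflated to B_n1 x B_n2 *)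
Definition bip_mx (g : signed_perm n1 * signed_perm n2) :=
  (-1) ^+ sign_changes g.2 *: tprod (specht F la.1 g.1.1) (specht F la.2 g.2.1).

Lemma bip_mx_repr : mx_repr [set: signed_perm n1 * signed_perm n2]%G bip_mx.
Proof.
split=> [|g h _ _]; rewrite /bip_mx.
  by rewrite sign_changes1 !repr_mx1 tprod1 scale1r.
rewrite -signr_odd odd_sign_changesM signr_addb !signr_odd.
rewrite !repr_mxM ?inE // tprodE.
by rewrite -scalemxAl -scalemxAr scalerA.
Qed.

Definition bip_repr := MxRepresentation bip_mx_repr.

Variables (n : nat) (n12 : (n1 + n2)%N = n).

(* B_n1 acts on the first n1 coordinates, B_n2 on the last n2 *)
Definition block_ord (s : 'S_n1) (t : 'S_n2) (i : 'I_n) : 'I_n :=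
  cast_ord n12 match split (cast_ord (esym n12) i) with
               | inl j => lshift n2 (s j)
               | inr k => rshift n1 (t k)
               end.

Lemma block_ord_inj s t : injective (block_ord s t).
Proof.
move=> i j /cast_ord_inj ij; apply: (@cast_ord_inj _ _ (esym n12)).
rewrite -(splitK (cast_ord _ i)) -(splitK (cast_ord _ j)); move: ij.
case: (split _) (split _) => [i1|i2] [j1|j2] /=.
- by move/lshift_inj/perm_inj->.
- by move/eqP; rewrite eq_rlshift.
- by move/eqP; rewrite eq_lrshift.
- by move/rshift_inj/perm_inj->.
Qed.

Definition block_embed (g : signed_perm n1 * signed_perm n2) : signed_perm n :=
  (perm (@block_ord_inj g.1.1 g.2.1),
   [ffun i => match split (cast_ord (esym n12) i) with
              | inl j => g.1.2 j
              | inr k => g.2.2 k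
              end]).

End Bipartition.

(* For an injective morphism phi : K -> G, the row module of rV is induced from
   that of rW: it contains a copy of it (the row space of B), and it is the direct
   sum of the translates of that copy by the right cosets of phi(K) in G. *)
Definition induced_along (F : fieldType) (gT kT : finGroupType)
    (G : {group gT}) (K : {group kT}) (phi : kT -> gT) e d
    (rW : mx_representation F K e) (rV : mx_representation F G d) : Prop :=
  exists B : 'M[F]_(e, d),
    [/\ row_free B,
        forall k, k \in K -> rW k *m B = B *m rV (phi k),
        (\sum_(X in rcosets (phi @: K) G) <<B *m rV (fingroup.repr X)>> :=: 1%:M)%MS
      & mxdirect (\sum_(X in rcosets (phi @: K) G) <<B *m rV (fingroup.repr X)>>)].

Lemma bipartition_size n la : bipartition n la -> (sumn la.1 + sumn la.2)%N = n.
Proof. by case/and3P=> _ _ /eqP. Qed.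

Definition is_Vla (F : fieldType) n (la : seq nat * seq nat)
    (bip : bipartition n la) d (rV : mx_representation F (Bn n) d) : Prop :=
  induced_along (block_embed (bipartition_size bip)) (bip_repr F la) rV.

Definition Dn_splitting (F : fieldType) n d (rV : mx_representation F (Bn n) d)
    dp (rVp : mx_representation F (Dn n) dp)
    dm (rVm : mx_representation F (Dn n) dm) : Prop :=
  [/\ mx_irreducible rVp, mx_irreducible rVm
    & mx_rsim (subg_repr rV (subsetT (Dn n)))
              (dadd_grepr (Representation rVp) (Representation rVm))].

(* Main.v *)
From HB Require Import structures.
Require Import Defs.
From mathcomp Require Import all_boot all_order all_fingroup all_algebra.
From mathcomp Require Import mxrepresentation character boolp reals complex ring zify.

(** Let W be a finite group generated by reflections, V an irreducible
    representation of W, and L a nonzero finite-dimensional quotient of the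
    standard module of V. Then L has a basis of vectors homogeneous for the degree
    in h^*, and the degree is the eigenvalue of the Euler element, shifted so as to
    vanish on V. Denote by theta the scalar by which the sum of the c_s s acts on
    V, and put

      Phi_g (t) = det (1 - t g) * sum_k t^k Tr (g | L_k)

    for g in W. The cyclicity of the trace of g t^deg x_j y_j and the commutation
    relations give the differential equation

      t Phi_g' = theta Phi_g - sum_s c_s Phi_(s g)

    (deriv_gtrace). If psi is a function on W that satisfies
    sum_s c_s psi (s^-1 h) = theta psi h for all h, then sum_g Phi_g psi g has
    zero derivative. Comparing its values at t = 1 and t = 0 yields
    elliptic_trace:

      sum_g det (1 - g) Tr (g | L) psi g = sum_g Tr (g | V) psi g.

    In type D, let s be a signed permutation with an odd number of sign changes,
    chi the character of V, and psi g = chi g - chi (g ^ s). This psi is admissible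
    because conjugation by s permutes the reflections of Dn. If det (1 - g) is not
    0, all cycles of g are negative; one such cycle, extended by the identity, is
    an element of Bn outside Dn that commutes with g (elliptic_commute), so g ^ s
    is conjugate to g in Dn and psi g = 0. Hence the left-hand side vanishes. If V
    is not isomorphic to its conjugate by s, the right-hand side is |Dn| by
    orthogonality of characters, a contradiction (Lc_infinite_dimensional).

    It remains to see that neither half of V_lambda is isomorphic to its conjugate
    by s when lambda is symmetric. By Mackey's criterion the character of V_lambda
    has norm k ^ 2, where k is the norm of the Specht character
    (char_norm_square), and it vanishes off Dn because exchanging the two blocks
    twists it by the sign-change character (char_vanish). So the norm over Dn is
    2 k ^ 2. As V_lambda restricts to a sum of two irreducible representations,
    this norm is 2 or 4, so k = 1: the two halves are not isomorphic, and V_lambda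
    has only scalar endomorphisms. If the character chi of one half were invariant
    under s, the sum of the chi (g^-1) g over Dn would commute with Bn, hence act
    on V_lambda by a scalar; but it vanishes on the other half and has nonzero
    trace (conjg_char_ortho). *)

Set Implicit Arguments.
Unset Strict Implicit.
Unset Printing Implicit Defensive.

Import GroupScope Order.TTheory GRing.Theory Num.Theory.
Local Open Scope ring_scope.

(** * Determinants *)

(** The matrix determinant lemma, with the adjugate in place of an inverse so
    that it applies to matrices of polynomials. The bordered matrix with rows
    (1, - v) and (u, M) has determinant det (M + u v) by eliminating u; after
    multiplication by det M, eliminating u by Cramer's rule instead gives the
    right-hand side. *)
Lemma det_add_rank1 (R : idomainType) n (M : 'M[R]_n) (u : 'cV[R]_n)
    (v : 'rV[R]_n) :
  \det M != 0 -> \det (M + u *m v) = \det M + (v *m \adj M *m u) 0 0.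
Proof.
move=> detM0; set D := \det M.
have fact1 : block_mx 1%:M (- v) u M
    = block_mx 1%:M 0 u 1%:M *m block_mx (1%:M : 'M_1) (- v) 0 (M + u *m v).
  by rewrite mulmx_block !mul1mx !mulmx1 !mul0mx !addr0 mulmxN addrC addrK.
have fact2 : block_mx 1%:M (- v) u M
      *m block_mx D%:M 0 (- (\adj M *m u)) 1%:M
    = block_mx (D%:M + v *m \adj M *m u) (- v) 0 M.
  rewrite mulmx_block !mul1mx !mulmx1 !mulmx0 !add0r mulNmx !mulmxN opprK.
  rewrite !mulmxA mul_mx_adj -/D mul_mx_scalar mul_scalar_mx subrr.
  by [].
have := congr1 determinant fact2.
rewrite det_mulmx det_lblock fact1 det_mulmx det_lblock !det_ublock !det1.
rewrite det_scalar1 !mul1r mulr1 det_mx11 !mxE eqxx mulr1n => detE.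
by apply: (mulIf detM0); rewrite detE.
Qed.

(** Jacobi's formula. *)
Lemma deriv_det (R : comNzRingType) n (M : 'M[{poly R}]_n) :
  (\det M)^`() = \tr (\adj M *m map_mx (@deriv R) M).
Proof.
have deriv_prod (G : 'I_n -> {poly R}) (r : seq 'I_n) : uniq r ->
    (\prod_(i <- r) G i)^`()
    = \sum_(i <- r) (G i)^`() * \prod_(j <- r | i != j) G j.
  elim: r => [|a r IH] /=; first by rewrite !big_nil derivC.
  case/andP=> ar ur; rewrite !big_cons derivM IH // eqxx /=; congr (_ * _ + _).
    rewrite [RHS]big_seq_cond [LHS]big_seq; apply: eq_bigl => j.
    by case: eqP ar => [<- /negbTE->|]; rewrite ?andbF ?andbT.
  rewrite mulr_sumr; apply: eq_big_seq => j jr; rewrite big_cons.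
  by case: eqP ar => [<-|_ _]; rewrite ?jr // mulrCA.
rewrite /(\det M) raddf_sum /=.
under eq_bigr => s _.
  rewrite -(rmorph_sign (@polyC R)) mul_polyC derivZ deriv_prod ?index_enum_uniq //.
  rewrite -mul_polyC rmorph_sign mulr_sumr.
  over.
rewrite exchange_big /= /mxtrace; under [RHS]eq_bigr do rewrite mxE.
rewrite [RHS]exchange_big /=; apply: eq_bigr => i _.
rewrite (partition_big (fun s : 'S_n => s i) predT) //=; apply: eq_bigr => j _.
rewrite !mxE expand_cofactor mulr_suml; apply: eq_bigr => s /eqP<-.
by rewrite mulrCA mulrC.
Qed.

(** * The differential equation for graded traces *)

(** A finite-dimensional module is given here in coordinates: X x, Y y and G g
    are the matrices of x in h^*, of y in h and of g in W, in a basis whose i-th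
    vector has degree e i. The Euler element, shifted by theta, acts as the
    matrix D of degrees. *)
Section TraceFormula.

Variables (F : numFieldType) (gT : finGroupType) (W : {group gT}) (n : nat).
Variables (rH : mx_representation F W n) (S : {set gT}) (c : gT -> F).
Variables (alpha : gT -> 'cV[F]_n) (alphav : gT -> 'rV[F]_n).
Hypothesis SW : S \subset W.
Hypothesis reflE : {in S, forall s, rH s = 1%:M - alpha s *m alphav s}.

Variables (N : nat) (X : 'cV[F]_n -> 'M[F]_N) (Y : 'rV[F]_n -> 'M[F]_N).
Variables (G : gT -> 'M[F]_N) (e : 'I_N -> nat) (theta : F).
Let D : 'M[F]_N := diag_mx (\row_i (e i)%:R).
Hypothesis XE : forall x, X x = \sum_i x i 0 *: X (delta_mx i 0).
Hypothesis GM : {in W &, forall g h, G (g * h)%g = G g *m G h}.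
Hypothesis GX : {in W, forall g x, G g *m X x = X (rH g *m x) *m G g}.
Hypothesis YX : forall y x, Y y *m X x - X x *m Y y = (pairing y x)%:M
  - \sum_(s in S) (c s * pairing y (alpha s) * pairing (alphav s) x) *: G s.
Hypothesis eulerE : D = \sum_j X (delta_mx j 0) *m Y (delta_mx 0 j)
  - \sum_(s in S) c s *: G s + theta%:M.
(* X x raises degrees by one. *)
Hypothesis DX : forall x, D *m X x - X x *m D = X x.

Local Notation pC := (map_mx (@polyC F : {rmorphism F -> {poly F}})).

(* The operator t ^ D, with t the variable of the polynomials. *)
Let tpow : 'M[{poly F}]_N := diag_mx (\row_i 'X^(e i)).

Let tpowX x : tpow *m pC (X x) = 'X *: (pC (X x) *m tpow).
Proof.
apply/matrixP=> i j; rewrite mul_diag_mx mul_mx_diag !mxE.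
have := congr1 (fun A : 'M_N => A i j) (DX x); rewrite /D mul_diag_mx mul_mx_diag !mxE.
move=> /eqP; rewrite [X in _ - X]mulrC -mulrBl -subr_eq0 -{2}[X x i j]mul1r -mulrBl.
rewrite mulf_eq0 => /orP[|/eqP->]; last by rewrite !(mulr0, mul0r).
rewrite -addrA -opprD natr1 subr_eq0 eqr_nat => /eqP->.
by rewrite exprS mulrC mulrCA.
Qed.

Let wtr g M := \tr (pC (G g) *m tpow *m pC M).

Let wtrD g M M' : wtr g (M + M') = wtr g M + wtr g M'.
Proof. by rewrite /wtr map_mxD mulmxDr mxtraceD. Qed.

Let wtrZ g a M : wtr g (a *: M) = a%:P * wtr g M.
Proof. by rewrite /wtr map_mxZ -scalemxAr mxtraceZ. Qed.

Let wtrB g M M' : wtr g (M - M') = wtr g M - wtr g M'.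
Proof. by rewrite wtrD -scaleN1r wtrZ polyCN mulN1r. Qed.

Let wtr_sum g I (r : seq I) (P : pred I) M_ :
  wtr g (\sum_(i <- r | P i) M_ i) = \sum_(i <- r | P i) wtr g (M_ i).
Proof.
elim/big_rec2: _ => [|i p M _ <-]; last by rewrite wtrD.
by rewrite -(scale0r 1%:M) wtrZ polyC0 mul0r.
Qed.

Definition gtrace g : {poly F} := \sum_i (G g i i)%:P * 'X^(e i).

Let wtr1 g : wtr g 1%:M = gtrace g.
Proof.
rewrite /wtr map_mx1 mulmx1 /mxtrace; apply: eq_bigr => i _.
by rewrite mul_mx_diag !mxE.
Qed.

Let wtrG g s : g \in W -> s \in W -> wtr g (G s) = gtrace (s * g)%g.
Proof.
move=> Wg Ws; rewrite -wtr1 /wtr map_mx1 mulmx1 mxtrace_mulC mulmxA -map_mxM.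
by rewrite -GM.
Qed.

Let wtr_degree g : wtr g D = 'X * (gtrace g)^`().
Proof.
rewrite /wtr /gtrace raddf_sum mulr_sumr /mxtrace; apply: eq_bigr => i _ /=.
rewrite map_diag_mx !mul_mx_diag !mxE mul_polyC derivZ derivXn -scalerAr.
rewrite -scalerAl rmorph_nat mulr_natr; congr (_ *: _).
by case: (e i) => [|k]; rewrite ?mulr0n ?mulr0 //= mulrnAr exprS.
Qed.

(* The cyclicity of the trace moves X x around t ^ D and G g, which costs a
   factor t and replaces x by g x. *)
Let wtrX g x Z : g \in W -> wtr g (X x *m Z) = 'X * wtr g (Z *m X (rH g *m x)).
Proof.
move=> Wg; rewrite /wtr !map_mxM mulmxA -(mulmxA _ tpow) tpowX -scalemxAr -!scalemxAl.
rewrite mxtraceZ; congr (_ * _).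
rewrite (mulmxA (pC (G g)) (pC (X x))).
rewrite -(map_mxM _ (G g)) GX // map_mxM.
by rewrite -!mulmxA mxtrace_mulC !mulmxA.
Qed.

(** The inverse, as a power series, of the graded trace of g on C[h], because g
    acts on h^* by left multiplication by rH g. *)
Definition charpoly_rev g : {poly F} := \det (1%:M - 'X *: pC (rH g)).

Lemma horner_charpoly_rev g x : (charpoly_rev g).[x] = \det (1%:M - x *: rH g).
Proof.
rewrite -/(horner_eval x _) -det_map_mx map_mxB map_mx1 map_mxZ /= /horner_eval hornerX.
by congr (\det (_ - _ *: _)); apply/matrixP=> i j; rewrite !mxE hornerC.
Qed.

Lemma charpoly_rev_neq0 g : charpoly_rev g != 0.
Proof.
apply/eqP => /(congr1 (fun p => p.[0])); rewrite horner_charpoly_rev.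
by rewrite scale0r subr0 det1 horner0 => /eqP; rewrite oner_eq0.
Qed.

(** Write F_g for the graded trace of g, A_g for the adjugate of 1 - t g and B
    for the matrix of the traces of g t^D x_i y_j. Moving x_i around the trace and
    back through y_j expresses B (1 - t g) in terms of F_g and of the F_(s g).
    Multiplying by A_g and taking traces leaves three ingredients: the trace of
    B is computed by the Euler element and contains t F_g'; the trace of A_g g is
    minus the derivative of det (1 - t g) by Jacobi's formula; and since s
    differs from 1 by a rank one matrix, the remaining terms turn
    det (1 - t g) F_(s g) into det (1 - t s g) F_(s g). *)
Lemma deriv_gtrace g : g \in W ->
  'X * (charpoly_rev g * gtrace g)^`()
  = theta%:P * (charpoly_rev g * gtrace g)
    - \sum_(s in S) (c s)%:P * (charpoly_rev (s * g)%g * gtrace (s * g)%g).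
Proof.
move=> Wg; pose M : 'M_n := 1%:M - 'X *: pC (rH g).
pose B : 'M_n := \matrix_(j, i) wtr g (X (delta_mx i 0) *m Y (delta_mx 0 j)).
have BM : B *m M = 'X *: (gtrace g *: pC (rH g)
    - \sum_(s in S) ((c s)%:P * gtrace (s * g)%g)
        *: pC (alpha s *m (alphav s *m rH g))).
  apply/matrixP=> j k; rewrite mulmxBr mulmx1 -scalemxAr.
  rewrite [LHS]mxE [X in _ + X]mxE [X in _ - X]mxE [RHS]mxE [B j k]mxE wtrX //.
  have YXe : Y (delta_mx 0 j) *m X (rH g *m delta_mx k 0)
    = \sum_i rH g i k *: (X (delta_mx i 0) *m Y (delta_mx 0 j))
    + ((rH g j k)%:M - \sum_(s in S) (c s * alpha s j 0 * (alphav s *m rH g) 0 k) *: G s).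
    have -> : \sum_i rH g i k *: (X (delta_mx i 0) *m Y (delta_mx 0 j))
       = X (rH g *m delta_mx k 0) *m Y (delta_mx 0 j).
      rewrite -colE [in RHS]XE mulmx_suml.
      by apply: eq_bigr => i _; rewrite mxE -scalemxAl.
    rewrite [X in _ + X](_ : _ = Y (delta_mx 0 j) *m X (rH g *m delta_mx k 0)
       - X (rH g *m delta_mx k 0) *m Y (delta_mx 0 j)); first by rewrite addrC subrK.
    rewrite YX; congr (_%:M - _).
      by rewrite /pairing mulmxA -rowE -colE !mxE.
    apply: eq_bigr => s _; congr (_ * _ * _ *: _).
      by rewrite /pairing -rowE mxE.
    by rewrite /pairing mulmxA -colE [RHS]mxE.
  rewrite YXe wtrD wtrB !wtr_sum mulrDr [X in X + _ - _](_ : _ = 'X * (B *m pC (rH g)) j k).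
    rewrite [X in X - _]addrC addrK -scalemx1 wtrZ wtr1; congr (_ * _).
    rewrite !mxE summxE mulrC; congr (_ - _); apply: eq_bigr => s Ss.
    move: (alphav s *m rH g) => w; rewrite wtrZ (wtrG Wg (subsetP SW _ Ss)).
    rewrite !mxE big_ord1 -!mulrA polyCM -mulrA; congr (_ * _).
    by rewrite mulrC.
  congr (_ * _); rewrite [RHS]mxE; apply: eq_bigr => i _.
  by rewrite wtrZ !mxE mulrC.
have mulM_adj : M *m \adj M = (charpoly_rev g)%:M by rewrite mul_mx_adj.
have trB : \tr B = 'X * (gtrace g)^`() + \sum_(s in S) (c s)%:P * gtrace (s * g)%g
    - theta%:P * gtrace g.
  have -> : \sum_(s in S) (c s)%:P * gtrace (s * g)%g = wtr g (\sum_(s in S) c s *: G s).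
    by rewrite wtr_sum; apply: eq_bigr => s Ss; rewrite wtrZ (wtrG Wg (subsetP SW _ Ss)).
  have -> : theta%:P * gtrace g = wtr g theta%:M by rewrite -scalemx1 wtrZ wtr1.
  rewrite -wtr_degree eulerE wtrD wtrB [X in X - _]addrAC subrK addrK wtr_sum.
  by apply: eq_bigr => j _; rewrite mxE.
have derM : (charpoly_rev g)^`() = - \tr (\adj M *m pC (rH g)).
  rewrite /charpoly_rev deriv_det -/M -raddfN -mulmxN; congr (\tr (_ *m _)).
  apply/matrixP=> i j; rewrite !mxE derivD derivN derivM derivX derivC mul1r mulr0.
  by rewrite addr0 derivMn derivC mul0rn sub0r.
have detS s : s \in S -> charpoly_rev (s * g)%g
    = charpoly_rev g + 'X * \tr (\adj M *m pC (alpha s *m (alphav s *m rH g))).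
  move=> Ss; rewrite {1}/charpoly_rev (repr_mxM _ (subsetP SW _ Ss) Wg) reflE // mulmxBl mul1mx.
  rewrite map_mxB scalerBr opprB addrCA addrC -[1%:M - _]/M -mulmxA map_mxM scalemxAl.
  rewrite det_add_rank1 ?charpoly_rev_neq0 //; congr (_ + _).
  rewrite -trace_mx11 -scalemxAr mxtraceZ; congr (_ * _).
  by rewrite -mulmxA mxtrace_mulC -!mulmxA.
have := congr1 (fun A => \tr (A *m \adj M)) BM.
rewrite /= -mulmxA mulM_adj mul_mx_scalar mxtraceZ -scalemxAl mxtraceZ mulmxBl mxtraceD raddfN.
rewrite -scalemxAl mxtraceZ mxtrace_mulC -[\tr (_ *m pC (rH g))]opprK -derM mulmx_suml.
rewrite [X in _ - X]raddf_sum /= => main.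
rewrite derivM mulrDr (eq_bigr (fun s => (c s)%:P * charpoly_rev g * gtrace (s * g)%g
  + 'X * \tr ((((c s)%:P * gtrace (s * g)%g)
        *: pC (alpha s *m (alphav s *m rH g))) *m \adj M))); last first.
  move=> s Ss; rewrite detS // -scalemxAl mxtraceZ [\tr (pC _ *m _)]mxtrace_mulC.
  by ring.
rewrite big_split /= -mulr_sumr.
move: main; rewrite trB.
set sum1 := \sum_(s in S) \tr _.
set sum2 := \sum_(s in S) _ * gtrace _ => main.
have -> : \sum_(s in S) (c s)%:P * charpoly_rev g * gtrace (s * g)%g
    = charpoly_rev g * sum2.
  by rewrite mulr_sumr; apply: eq_bigr => s _; rewrite mulrAC mulrC.
have -> : 'X * (charpoly_rev g * (gtrace g)^`())
  = charpoly_rev g * ('X * (gtrace g)^`() + sum2 - theta%:P * gtrace g)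
    - charpoly_rev g * sum2 + theta%:P * (charpoly_rev g * gtrace g) by ring.
by rewrite main; ring.
Qed.

Lemma deriv_eq0_horner (p : {poly F}) x y : p^`() = 0 -> p.[x] = p.[y].
Proof.
move=> dp0; suff -> : p = (p`_0)%:P by rewrite !hornerC.
apply/polyP=> -[|i]; rewrite coefC //=; apply/eqP.
by have /eqP := coef_deriv p i; rewrite dp0 coef0 eq_sym -mulr_natr mulf_eq0 pnatr_eq0 orbF.
Qed.

(** Pairing the differential equation with psi, an eigenvector of the operator
    on functions on W that occurs in it, gives a polynomial with zero derivative.
    Its values at 1 and at 0 are the two sides. *)
Lemma trace_formula (psi : gT -> F) :
  {in W, forall h, \sum_(s in S) c s * psi (s^-1 * h)%g = theta * psi h} ->
  \sum_(g in W) \det (1%:M - rH g) * \tr (G g) * psi g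
  = \sum_(g in W) (\sum_(i | e i == 0%N) G g i i) * psi g.
Proof.
move=> psiS.
pose P := \sum_(g in W) charpoly_rev g * gtrace g * (psi g)%:P.
have hornerP x : P.[x]
    = \sum_(g in W) (charpoly_rev g).[x] * (gtrace g).[x] * psi g.
  by rewrite horner_sum; apply: eq_bigr => g _; rewrite !hornerM hornerC.
have gtrE g x : (gtrace g).[x] = \sum_i G g i i * x ^+ e i.
  by rewrite horner_sum; apply: eq_bigr => i _; rewrite hornerM hornerC hornerXn.
have : P.[1] = P.[0].
  apply: deriv_eq0_horner; apply: (@mulfI _ 'X); rewrite ?polyX_eq0 // mulr0.
  rewrite raddf_sum mulr_sumr /=.
  under eq_bigr => g Wg do rewrite derivM derivC mulr0 addr0 mulrA deriv_gtrace //
    mulrBl [(\sum_(s in S) _) * _]mulr_suml.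
  rewrite sumrB; apply/eqP; rewrite subr_eq0; apply/eqP.
  have -> : \sum_(g in W) theta%:P * (charpoly_rev g * gtrace g) * (psi g)%:P
    = \sum_(g in W) \sum_(s in S)
        (c s)%:P * (charpoly_rev g * gtrace g) * (psi (s^-1 * g)%g)%:P.
    apply: eq_bigr => g Wg; rewrite mulrAC -polyCM -psiS // rmorph_sum [LHS]mulr_suml.
    by apply: eq_bigr => s _; rewrite rmorphM mulrAC.
  rewrite exchange_big [RHS]exchange_big /=; apply: eq_bigr => s Ss.
  rewrite (reindex_inj (mulgI s)) /=; apply: eq_big => g.
    by rewrite groupMl // (subsetP SW).
  by rewrite mulKg.
rewrite !hornerP => {hornerP}.
under eq_bigr => g _ do rewrite horner_charpoly_rev gtrE scale1r.
under [X in _ = X -> _]eq_bigr => g _ do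
  rewrite horner_charpoly_rev gtrE scale0r subr0 det1 mul1r.
move=> eqP01; transitivity (\sum_(g in W)
    \det (1%:M - rH g) * (\sum_i G g i i * 1 ^+ e i) * psi g).
  apply: eq_bigr => g _; congr (_ * _ * _).
  by apply: eq_bigr => i _; rewrite expr1n mulr1.
rewrite eqP01; apply: eq_bigr => g _; congr (_ * _); rewrite [RHS]big_mkcond /=.
by apply: eq_bigr => i _; rewrite expr0n; case: (e i) => [|k]; rewrite ?mulr1 ?mulr0.
Qed.


End TraceFormula.

(** * Relations in the Cherednik algebra *)

Lemma pairing_delta (F : fieldType) n (x : 'cV[F]_n) j :
  pairing (delta_mx 0 j) x = x j 0.
Proof. by rewrite /pairing -rowE mxE. Qed.

Section CherednikRelations.

Variables (F : fieldType) (gT : finGroupType) (W : {group gT}) (n : nat).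
Variables (rH : mx_representation F W n) (c : gT -> F).
Variables (alpha : gT -> 'cV[F]_n) (alphav : gT -> 'rV[F]_n).

Local Notation H := (cherednik rH c alpha alphav).
Local Notation scal := (cher_scal rH c alpha alphav).
Local Notation grp := (cher_grp rH c alpha alphav).
Local Notation pos := (cher_pos rH c alpha alphav).
Local Notation cof := (cher_of rH c alpha alphav).
Local Notation mom := (cher_mom rH c alpha alphav).

Lemma cher_scalD a b : scal (a + b) = scal a + scal b :> H.
Proof. by rewrite [RHS]cher_addE; apply/cher_ofP/ce_scalD. Qed.

Lemma cher_scalM a b : scal (a * b) = scal a * scal b :> H.
Proof. by rewrite [RHS]cher_mulE; apply/cher_ofP/ce_scalM. Qed.

Lemma cher_scal0 : scal 0 = 0 :> H. Proof. by []. Qed.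

Lemma cher_scal1 : scal 1 = 1 :> H. Proof. by []. Qed.

Lemma cher_scalC a (h : H) : scal a * h = h * scal a.
Proof.
have [t ->] := cher_of_surj h.
by rewrite [LHS]cher_mulE [RHS]cher_mulE; apply/cher_ofP/ce_scalC.
Qed.

Lemma cher_scalN a : scal (- a) = - scal a :> H.
Proof. by apply/eqP; rewrite -addr_eq0 -cher_scalD addNr cher_scal0. Qed.

Lemma cher_grpM w w' : grp (w * w')%g = grp w * grp w' :> H.
Proof. by rewrite [RHS]cher_mulE; apply/cher_ofP/ce_grpM. Qed.

Lemma cher_posL a x x' : pos (a *: x + x') = scal a * pos x + pos x' :> H.
Proof. by rewrite [_ * _]cher_mulE [RHS]cher_addE; apply/cher_ofP/ce_posL. Qed.

Lemma cher_posD x x' : pos (x + x') = pos x + pos x' :> H.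
Proof. by rewrite -{1}(scale1r x) cher_posL cher_scal1 mul1r. Qed.

Lemma cher_pos0 : pos 0 = 0 :> H.
Proof. by apply: (addIr (pos 0)); rewrite -cher_posD !add0r. Qed.

Lemma cher_posZ a x : pos (a *: x) = scal a * pos x :> H.
Proof. by rewrite -[a *: x]addr0 cher_posL cher_pos0 addr0. Qed.

Lemma cher_pos_sum I (r : seq I) (P : pred I) x_ :
  pos (\sum_(i <- r | P i) x_ i) = \sum_(i <- r | P i) pos (x_ i) :> H.
Proof. exact: (big_morph _ cher_posD cher_pos0). Qed.

Lemma cher_pos_delta x : pos x = \sum_j scal (x j 0) * pos (delta_mx j 0) :> H.
Proof.
rewrite {1}(matrix_sum_delta x) cher_pos_sum; apply: eq_bigr => j _.
by rewrite big_ord1 cher_posZ.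
Qed.

Lemma cher_posC x x' : pos x * pos x' = pos x' * pos x :> H.
Proof. by rewrite [LHS]cher_mulE [RHS]cher_mulE; apply/cher_ofP/ce_posC. Qed.

Lemma cher_grp_pos w x : grp w * pos x = pos (rH (sgval w) *m x) * grp w :> H.
Proof. by rewrite [LHS]cher_mulE [RHS]cher_mulE; apply/cher_ofP/ce_grp_pos. Qed.

Lemma cher_mom_pos y x : mom y * pos x = pos x * mom y + (scal (pairing y x)
  - \sum_(s : subg_of W | is_reflection rH (sgval s))
      scal (c (sgval s) * pairing y (alpha (sgval s))
                         * pairing (alphav (sgval s)) x) * grp s) :> H.
Proof.
have SubE t u : cof (Defs.Sub t u) = cof t - cof u :> H.
  by rewrite /Defs.Sub -cher_addE -cher_oppE.
rewrite addrC; apply/eqP; rewrite -subr_eq; apply/eqP.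
rewrite [pos x * _]cher_mulE [mom y * _]cher_mulE -SubE.
transitivity (cof (cher_comm rH c alpha alphav y x) : H).
  exact/cher_ofP/ce_mom_pos.
rewrite /cher_comm SubE; congr (_ - _).
rewrite (@big_morph _ _ cof 0 +%R (Scal _ _ 0) (@Add F gT W n)) //.
  by apply: eq_bigr => s _; rewrite [RHS]cher_mulE.
by move=> t u; rewrite [RHS]cher_addE.
Qed.

Hypothesis reflE : forall s, is_reflection rH s ->
  rH s = 1%:M - alpha s *m alphav s.

(** The Euler element, shifted by theta in order to kill the lowest weight space
    when the sum of the c_s s acts there by theta. *)
Definition euler theta : H := \sum_j pos (delta_mx j 0) * mom (delta_mx 0 j)
  - \sum_(s : subg_of W | is_reflection rH (sgval s)) scal (c (sgval s)) * grp s
  + scal theta.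

(** In the commutator of the sum of the x_j y_j with x, the pairing contributes
    x, and the reflection s contributes - c_s <x, alphav_s> alpha_s s. The latter
    is cancelled by the commutator of x with - c_s s. *)
Lemma euler_pos theta x : euler theta * pos x = pos x * euler theta + pos x.
Proof.
have pairE s : scal (pairing (alphav s) x) * pos (alpha s)
   = \sum_j scal (pairing (delta_mx 0 j) (alpha s) * pairing (alphav s) x)
       * pos (delta_mx j 0) :> H.
  rewrite cher_pos_delta mulr_sumr; apply: eq_bigr => j _.
  by rewrite mulrA -cher_scalM pairing_delta [X in scal X * _]mulrC.
have posE : pos x = \sum_j scal (pairing (delta_mx 0 j) x) * pos (delta_mx j 0) :> H.
  by rewrite cher_pos_delta; apply: eq_bigr => j _; rewrite pairing_delta.
have -> : euler theta * pos x = (\sum_j pos (delta_mx j 0) * mom (delta_mx 0 j)) * pos x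
    - (\sum_(s : subg_of W | is_reflection rH (sgval s)) scal (c (sgval s)) * grp s)
      * pos x + pos x * scal theta.
  by rewrite /euler mulrDl mulrBl cher_scalC.
have -> : (\sum_j pos (delta_mx j 0) * mom (delta_mx 0 j)) * pos x
  = pos x * (\sum_j pos (delta_mx j 0) * mom (delta_mx 0 j)) + pos x
   - \sum_(s : subg_of W | is_reflection rH (sgval s))
      scal (c (sgval s) * pairing (alphav (sgval s)) x) * pos (alpha (sgval s)) * grp s.
  rewrite mulr_suml (eq_bigr (fun j => pos x * (pos (delta_mx j 0) * mom (delta_mx 0 j))
    + (scal (pairing (delta_mx 0 j) x) * pos (delta_mx j 0)
    - \sum_(s : subg_of W | is_reflection rH (sgval s))
      scal (c (sgval s) * pairing (delta_mx 0 j) (alpha (sgval s))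
            * pairing (alphav (sgval s)) x) * pos (delta_mx j 0) * grp s))).
    rewrite big_split /= -mulr_sumr sumrB -posE exchange_big /= addrA; congr (_ - _).
    apply: eq_bigr => s _; rewrite -mulr_suml; congr (_ * _).
    rewrite cher_scalM -mulrA pairE mulr_sumr; apply: eq_bigr => j _.
    by rewrite mulrA -cher_scalM mulrA.
  move=> j _; rewrite -mulrA cher_mom_pos mulrDr !mulrA [pos x * _]cher_posC; congr (_ + _).
  rewrite mulrBr cher_scalC; congr (_ - _); rewrite mulr_sumr; apply: eq_bigr => s _.
  by rewrite mulrA cher_scalC.
have -> : (\sum_(s : subg_of W | is_reflection rH (sgval s)) scal (c (sgval s)) * grp s)
      * pos x
    = pos x * (\sum_(s : subg_of W | is_reflection rH (sgval s)) scal (c (sgval s)) * grp s)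
    - \sum_(s : subg_of W | is_reflection rH (sgval s))
      scal (c (sgval s) * pairing (alphav (sgval s)) x) * pos (alpha (sgval s)) * grp s.
  rewrite mulr_suml mulr_sumr -sumrB; apply: eq_bigr => s rs.
  rewrite -mulrA cher_grp_pos reflE // mulmxBl mul1mx -mulmxA.
  rewrite [alphav _ *m x]mx11_scalar mul_mx_scalar -/(pairing _ _) -scaleNr addrC.
  rewrite cher_posL cher_scalN mulrDl !mulNr mulrDr mulrN addrC.
  by rewrite !mulrA -cher_scalM cher_scalC.
rewrite /euler mulrDr mulrBr opprB [RHS]addrAC; congr (_ + _).
by rewrite addrA subrK addrAC.
Qed.


End CherednikRelations.

(** * Homogeneous bases of lowest weight modules *)

(** A spanning family of minimal size is a basis. The predicate P serves to
    choose a basis of homogeneous vectors. *)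
Lemma basis_of_spanning (F : fieldType) (V : lmodType F) (P : V -> Prop)
    (I : finType) (b : I -> V) :
    (forall i, P (b i)) ->
    (forall v, exists a : I -> F, v = \sum_i a i *: b i) ->
  exists N (h : 'I_N -> V) (phi : V -> 'cV[F]_N), (forall i, P (h i)) /\
    forall v x, phi v = x <-> v = \sum_i x i 0 *: h i.
Proof.
move=> Pb spanb.
pose Q N := `[< exists h : 'I_N -> V, (forall i, P (h i)) /\
  forall v, exists x : 'cV[F]_N, v = \sum_i x i 0 *: h i >].
have exQ : exists N, Q N.
  exists #|I|; apply/asboolP; exists (fun i => b (enum_val i)); split=> // v.
  have [a ->] := spanb v; exists (\col_i a (enum_val i)).
  rewrite (reindex_onto (@enum_rank I) enum_val) /=; last by move=> i _; exact: enum_valK.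
  by apply: eq_big => [i|i _]; rewrite ?enum_rankK ?eqxx // mxE enum_rankK.
case: (ex_minnP exQ) => N /asboolP[h [Ph spanh]] minN.
have free (x : 'cV[F]_N) : \sum_i x i 0 *: h i = 0 -> x = 0.
  move=> hx; apply/colP=> j; rewrite mxE; apply/eqP/negPn/negP=> xj0.
  case: N h Ph spanh minN x hx j xj0 => [|N] h Ph spanh minN x hx j xj0; first by case: j xj0.
  suff : Q N by move/minN; rewrite ltnn.
  apply/asboolP; exists (h \o lift j); split=> [i|v]; first exact: Ph.
  have [a ->] := spanh v.
  exists (\col_i (a (lift j i) 0 - a j 0 / x j 0 * x (lift j i) 0)).
  transitivity (\sum_i (a i 0 - a j 0 / x j 0 * x i 0) *: h i).
    under [RHS]eq_bigr do rewrite scalerBl -scalerA.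
    by rewrite sumrB -scaler_sumr hx scaler0 subr0.
  rewrite (bigD1_ord j) //= mulfVK // subrr scale0r add0r.
  by apply: eq_bigr => i _; rewrite mxE.
have [phi phiE] := choice spanh.
exists N, h, phi; split=> // v x; split=> [<- //|vE].
apply/eqP; rewrite -subr_eq0; apply/eqP/free.
under eq_bigr do rewrite !mxE scalerBl.
by rewrite sumrB -phiE -vE subrr.
Qed.

Lemma quot_ofL (A : pzRingType) (M : lmodType A) (X : M -> Prop) a u v :
  quot_of X (a *: u + v) = a *: (quot_of X u : quot_module X) + quot_of X v.
Proof. by rewrite [a *: quot_of _ _]quot_scaleE [RHS]quot_addE. Qed.

Lemma sum_subg (V : nmodType) (gT : finGroupType) (W : {group gT}) (P : pred gT)
    (E : gT -> V) :
  {subset P <= W} -> \sum_(s : subg_of W | P (sgval s)) E (sgval s) = \sum_(s | P s) E s.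
Proof.
move=> PW; rewrite [RHS](reindex_onto (@sgval _ W) (subg W)) => [|s Ps].
  by apply: eq_bigl => s; rewrite sgvalK eqxx andbT.
exact/subgK/PW.
Qed.

Section RestrictScalars.

Variables (F : fieldType) (gT : finGroupType) (W : {group gT}) (n : nat).
Variables (rH : mx_representation F W n) (c : gT -> F).
Variables (alpha : gT -> 'cV[F]_n) (alphav : gT -> 'rV[F]_n).

Local Notation H := (cherednik rH c alpha alphav).
Local Notation scal := (cher_scal rH c alpha alphav).

(** An alias, so that L can be an F-module next to its structure of module over
    the Cherednik algebra. *)
Definition restrict_scalars (L : lmodType H) : Type := L.

Variable L : lmodType H.

HB.instance Definition _ := GRing.Zmodule.on (restrict_scalars L).

Let rscale (a : F) (v : restrict_scalars L) : restrict_scalars L :=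
  scal a *: (v : L).

Let rscaleA a b v : rscale a (rscale b v) = rscale (a * b) v.
Proof. by rewrite /rscale scalerA cher_scalM. Qed.

Let rscale1 : left_id 1 rscale.
Proof. by move=> v; rewrite /rscale cher_scal1 scale1r. Qed.

Let rscaleDr : right_distributive rscale +%R.
Proof. by move=> a u v; rewrite /rscale scalerDr. Qed.

Let rscaleDl v : {morph rscale^~ v : a b / a + b}.
Proof. by move=> a b; rewrite /rscale cher_scalD scalerDl. Qed.

HB.instance Definition _ := GRing.Zmodule_isLmodule.Build F (restrict_scalars L)
  rscaleA rscale1 rscaleDr rscaleDl.

End RestrictScalars.

Section LowestWeightModule.

Variables (F : numFieldType) (gT : finGroupType) (W : {group gT}) (n : nat).
Variables (rH : mx_representation F W n) (c : gT -> F).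
Variables (alpha : gT -> 'cV[F]_n) (alphav : gT -> 'rV[F]_n).

Local Notation H := (cherednik rH c alpha alphav).
Local Notation scal := (cher_scal rH c alpha alphav).
Local Notation grp := (cher_grp rH c alpha alphav).
Local Notation pos := (cher_pos rH c alpha alphav).
Local Notation mom := (cher_mom rH c alpha alphav).

Hypothesis reflE : forall s, is_reflection rH s ->
  rH s = 1%:M - alpha s *m alphav s.

Variables (d : nat) (rV : mx_representation F W d) (theta : F).
Hypothesis theta_rV :
  \sum_(s | is_reflection rH s) c s *: rV s^-1%g = theta%:M.

Variables (L : lmodType H) (f : {linear standard_module rH c alpha alphav rV -> L}).
Hypothesis f_surj : forall v, exists u, f u = v.

Definition lowest (v : 'rV[F]_d) : L := f (quot_of _ (one_tensor rH c alpha alphav v)).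

Lemma lowest_lin a u v : lowest (a *: u + v) = scal a *: lowest u + lowest v.
Proof.
rewrite /lowest -linearZ -linearD -quot_ofL; congr (f (quot_of _ _)).
by apply/rowP=> j; rewrite !mxE cher_scalD cher_scalM.
Qed.

Lemma lowest0 : lowest 0 = 0.
Proof.
by have := lowest_lin (-1) 0 0; rewrite scaler0 addr0 cher_scalN cher_scal1 scaleN1r addNr.
Qed.

Lemma lowestZ a v : lowest (a *: v) = scal a *: lowest v.
Proof. by rewrite -[a *: v]addr0 lowest_lin lowest0 addr0. Qed.

Lemma lowestD u v : lowest (u + v) = lowest u + lowest v.
Proof. by rewrite -{1}(scale1r u) lowest_lin cher_scal1 scale1r. Qed.

Lemma lowest_sum I (r : seq I) (P : pred I) v_ :
  lowest (\sum_(i <- r | P i) v_ i) = \sum_(i <- r | P i) lowest (v_ i).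
Proof. exact: (big_morph _ lowestD lowest0). Qed.

Lemma mom_lowest y v : mom y *: lowest v = 0.
Proof.
rewrite /lowest -linearZ -[_ *: quot_of _ _]addr0 -quot_ofL -[RHS]lowest0 addr0.
congr (f _); apply/quot_ofP; rewrite (_ : one_tensor _ _ _ _ 0 = 0).
  by rewrite subr0; apply/sg_gen/sr_mom.
by apply/rowP=> j; rewrite !mxE.
Qed.

Lemma grp_lowest (w : subg_of W) v :
  grp w *: lowest v = lowest (v *m rV (sgval w)^-1%g).
Proof.
rewrite /lowest -linearZ -[_ *: quot_of _ _]addr0 -quot_ofL addr0; congr (f _).
by apply/quot_ofP/sg_gen/sr_grp.
Qed.

(** Degree k is the span of the products of k elements of h^* applied to lowest
    weight vectors. *)
Inductive homogeneous : nat -> L -> Prop :=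
| homogeneous_lowest v : homogeneous 0 (lowest v)
| homogeneous0 k : homogeneous k 0
| homogeneousL k a u v :
    homogeneous k u -> homogeneous k v -> homogeneous k (scal a *: u + v)
| homogeneous_pos k x v : homogeneous k v -> homogeneous k.+1 (pos x *: v).

Lemma homogeneousD k u v : homogeneous k u -> homogeneous k v -> homogeneous k (u + v).
Proof. by move=> hu hv; rewrite -[u]scale1r -cher_scal1; apply: homogeneousL. Qed.

Lemma homogeneousZ k a u : homogeneous k u -> homogeneous k (scal a *: u).
Proof.
by move=> hu; rewrite -[_ *: _]addr0; apply: homogeneousL => //; apply: homogeneous0.
Qed.

Lemma homogeneousB k u v : homogeneous k u -> homogeneous k v -> homogeneous k (u - v).
Proof.
move=> hu hv; rewrite addrC -scaleN1r -cher_scal1 -cher_scalN.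
exact: homogeneousL.
Qed.

Lemma homogeneous_sum k I (r : seq I) (P : pred I) v_ :
  (forall i, P i -> homogeneous k (v_ i)) -> homogeneous k (\sum_(i <- r | P i) v_ i).
Proof.
by move=> hv; elim/big_ind: _ => //; [apply: homogeneous0 | apply: homogeneousD].
Qed.

Lemma homogeneous_grp k w v : homogeneous k v -> homogeneous k (grp w *: v).
Proof.
elim=> {k v} [v|k|k a u v _ hu _ hv|k x v _ hv].
- by rewrite grp_lowest; apply: homogeneous_lowest.
- by rewrite scaler0; apply: homogeneous0.
- by rewrite scalerDr scalerA -cher_scalC -scalerA; apply: homogeneousL.
- by rewrite scalerA cher_grp_pos -scalerA; apply: homogeneous_pos.
Qed.

(** Moving y to the right through x produces <y, x> and reflections, which
    preserve degrees. This is why the homogeneous vectors span a submodule. *)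
Lemma homogeneous_mom k y v : homogeneous k v ->
  if k is k'.+1 then homogeneous k' (mom y *: v) else mom y *: v = 0.
Proof.
elim=> {k v} [v|k|k a u v _ hu _ hv|k x v hv ymv].
- exact: mom_lowest.
- by case: k => [|k]; rewrite scaler0 //; apply: homogeneous0.
- have -> : mom y *: (scal a *: u + v) = scal a *: (mom y *: u) + mom y *: v.
    by rewrite scalerDr !scalerA cher_scalC.
  case: k hu hv => [-> ->|k hu hv]; first by rewrite scaler0 addr0.
  exact: homogeneousL.
- rewrite scalerA cher_mom_pos scalerDl -scalerA; apply: homogeneousD.
    by case: k hv ymv => [_ ->|k _ /homogeneous_pos//]; rewrite scaler0; apply: homogeneous0.
  rewrite scalerBl; apply: homogeneousB; first exact: homogeneousZ.
  rewrite scaler_suml; apply: homogeneous_sum => s _; rewrite -scalerA.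
  exact/homogeneousZ/homogeneous_grp.
Qed.

Lemma euler_lowest v : euler rH c alpha alphav theta *: lowest v = 0.
Proof.
rewrite /euler scalerDl scalerBl scaler_suml big1 => [|j _]; last first.
  by rewrite -scalerA mom_lowest scaler0.
rewrite scaler_suml; under eq_bigr do rewrite -scalerA grp_lowest -lowestZ.
rewrite -lowest_sum (sum_subg (fun s => c s *: (v *m rV s^-1%g))); last first.
  by move=> s /andP[].
under eq_bigr do rewrite scalemxAr.
by rewrite -mulmx_sumr theta_rV mul_mx_scalar lowestZ sub0r addNr.
Qed.

Lemma euler_homogeneous k v : homogeneous k v ->
  euler rH c alpha alphav theta *: v = scal k%:R *: v.
Proof.
elim=> {k v} [v|k|k a u v _ IHu _ IHv|k x v _ IH].
- by rewrite euler_lowest scale0r.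
- by rewrite !scaler0.
- rewrite !scalerDr !scalerA -cher_scalC -scalerA IHu IHv !scalerA.
  by rewrite cher_scalC.
- rewrite !scalerA (euler_pos c reflE) scalerDl -scalerA IH scalerA -cher_scalC.
  by rewrite -natr1 cher_scalD mulrDl cher_scal1 mul1r scalerDl.
Qed.

Lemma homogeneous_lowestP v : homogeneous 0 v -> exists u, v = lowest u.
Proof.
suff homP k : homogeneous k v -> k = 0%N -> exists u, v = lowest u by move/homP; apply.
elim=> {k v} //.
- by move=> v _; exists v.
- by move=> k _; exists 0; rewrite lowest0.
- by move=> k a u v _ IHu _ IHv k0; have [[u' ->] [v' ->]] := (IHu k0, IHv k0);
    exists (a *: u' + v'); rewrite lowest_lin.
Qed.

Definition graded (v : L) := exists2 s : seq L,
  (forall u, u \in s -> exists k, homogeneous k u) & v = \sum_(u <- s) u.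

Lemma homogeneous_graded k v : homogeneous k v -> graded v.
Proof.
move=> hv; exists [:: v]; last by rewrite big_seq1.
by move=> u; rewrite inE => /eqP->; exists k.
Qed.

Lemma gradedD u v : graded u -> graded v -> graded (u + v).
Proof.
move=> [s hs ->] [t ht ->]; exists (s ++ t); last by rewrite big_cat.
by move=> w; rewrite mem_cat => /orP[/hs|/ht].
Qed.

Lemma graded_action (h : H) v : graded v -> graded (h *: v).
Proof.
have homG (h' : H) u : (forall k w, homogeneous k w -> graded (h' *: w)) ->
    graded u -> graded (h' *: u).
  move=> hh' [s hs ->]; elim: s hs => [|w s IH] hs.
    by rewrite big_nil scaler0; apply: homogeneous_graded (homogeneous0 0).
  rewrite big_cons scalerDr; apply: gradedD.
    by have [k /hh'] := hs w (mem_head _ _).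
  by apply: IH => u' us; apply: hs; rewrite inE us orbT.
have [t ->] := cher_of_surj h; elim: t v => {h}.
- by move=> a v; apply: homG => k w hw; apply: (@homogeneous_graded k); apply: homogeneousZ.
- by move=> w v; apply: homG => k u hu; apply: (@homogeneous_graded k); apply: homogeneous_grp.
- move=> x v; apply: homG => k w hw; apply: (@homogeneous_graded k.+1).
  exact: homogeneous_pos.
- move=> y v; apply: homG => -[|k] w /(homogeneous_mom y) hw.
    by rewrite [_ *: w]hw; apply: homogeneous_graded (homogeneous0 0).
  exact: (@homogeneous_graded k).
- move=> t IHt u IHu v gv; rewrite -cher_addE [_ *: v]scalerDl.
  by apply: gradedD; [apply: IHt | apply: IHu].
- by move=> t IHt u IHu v gv; rewrite -cher_mulE -[_ *: v]scalerA; apply/IHt/IHu.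
Qed.

Lemma all_graded v : graded v.
Proof.
have [u <-] := f_surj v; have [w ->] := quot_of_surj u.
have -> : w = \sum_j w 0 j *: one_tensor rH c alpha alphav (delta_mx 0 j).
  rewrite {1}(row_sum_delta w); apply: eq_bigr => j _; congr (_ *: _).
  by apply/rowP=> i; rewrite !mxE; case: (_ && _).
elim/big_rec: _ => [|j p _ gp]; last first.
  rewrite quot_ofL linearD linearZ; apply: gradedD => //.
  exact/graded_action/homogeneous_graded/homogeneous_lowest.
rewrite (_ : 0 = one_tensor rH c alpha alphav 0); last by apply/rowP=> i; rewrite !mxE.
exact/homogeneous_graded/homogeneous_lowest.
Qed.

Hypothesis irrV : mx_irreducible rV.
Hypothesis L_neq0 : exists v : L, v != 0.

(** The formula that obstructs finite dimension. The left-hand side sees only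
    elliptic elements, that is, elements without nonzero fixed vector in h,
    while the right-hand side pairs psi with the character of V. The inverse on
    the right comes from rV acting on row vectors from the right; chi is the
    character of W on L.

    After choosing a homogeneous basis this is the formula trace_formula. Its
    right-hand side involves the trace of g on the part of degree 0. That part
    is the image of V, and V maps injectively because it is irreducible and L is
    generated by its image. *)
Theorem elliptic_trace : finite_dimensional L -> exists chi : gT -> F,
  forall psi : gT -> F,
    {in W, forall h, \sum_(s | is_reflection rH s) c s * psi (s^-1 * h)%g
                     = theta * psi h} ->
  \sum_(g in W) \det (1%:M - rH g) * chi g * psi g
  = \sum_(g in W) \tr (rV g^-1%g) * psi g.
Proof.
case=> m [b spanb].
have /choice[s_ s_P] : forall i, exists s : seq L,
    (forall u, u \in s -> exists k, homogeneous k u) /\ b i = \sum_(u <- s) u.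
  by move=> i; have [s hs bs] := all_graded (b i); exists s.
have [N [h [phi [homh phiP]]]] : exists N (h : 'I_N -> L) (phi : L -> 'cV[F]_N),
   (forall i, exists k, homogeneous k (h i))
   /\ forall v x, phi v = x <-> v = \sum_i scal (x i 0) *: h i.
  pose I := {i : 'I_m & 'I_(size (s_ i))}.
  apply: (@basis_of_spanning F (restrict_scalars L) (fun v => exists k, homogeneous k v)
    I (fun p => nth 0 (s_ (tag p)) (tagged p))).
    by move=> [i j]; case: (s_P i) => hs _; apply/hs/mem_nth.
  move=> v; have [a ->] := spanb v; exists (fun p : I => a (tag p)).
  rewrite -(@sig_big_dep _ _ _ _ (fun i => 'I_(size (s_ i))) xpredT (fun _ => xpredT)
     (fun i j => a i *: (nth 0 (s_ i) j : restrict_scalars L))) /=.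
  apply: eq_bigr => i _; case: (s_P i) => _ ->.
  by rewrite -scaler_sumr (big_nth 0) big_mkord.
have phi_h v : v = \sum_i scal (phi v i 0) *: h i by apply/phiP.
have phiL a u v : phi (scal a *: u + v) = a *: phi u + phi v.
  apply/phiP; rewrite {1}[u]phi_h {1}[v]phi_h scaler_sumr -big_split /=.
  by apply: eq_bigr => i _; rewrite !mxE cher_scalD cher_scalM scalerA scalerDl.
have phiD u v : phi (u + v) = phi u + phi v.
  by rewrite -[u in LHS]scale1r -cher_scal1 phiL scale1r.
have phi0 : phi 0 = 0.
  by apply/phiP; rewrite big1 // => i _; rewrite mxE cher_scal0 scale0r.
have phi_sum I (r : seq I) (P : pred I) v_ :
    phi (\sum_(i <- r | P i) v_ i) = \sum_(i <- r | P i) phi (v_ i).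
  exact: (big_morph _ phiD phi0).
have phiZ a v : phi (scal a *: v) = a *: phi v.
  by rewrite -[scal a *: v]addr0 phiL phi0 addr0.
have phi_delta j : phi (h j) = delta_mx j 0.
  apply/phiP; rewrite (bigD1 j) //= big1 => [|i /negbTE ij]; rewrite mxE ?ij ?eqxx.
    by rewrite addr0 cher_scal1 scale1r.
  by rewrite cher_scal0 scale0r.
pose rho (a : H) : 'M[F]_N := \matrix_(i, j) phi (a *: h j) i 0.
have rhoE a v : phi (a *: v) = rho a *m phi v.
  rewrite {1}[v]phi_h scaler_sumr phi_sum; apply/colP=> i; rewrite summxE !mxE.
  by apply: eq_bigr => j _; rewrite scalerA -cher_scalC -scalerA phiZ !mxE mulrC.
have phi_ext (A B : 'M[F]_N) : (forall v, A *m phi v = B *m phi v) -> A = B.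
  move=> AB; apply/matrixP=> i j; have := congr1 (fun M : 'cV_N => M i 0) (AB (h j)).
  by rewrite phi_delta -!colE !mxE.
have rhoD a a' : rho (a + a') = rho a + rho a'.
  by apply: phi_ext => v; rewrite mulmxDl -!rhoE scalerDl phiD.
have rhoM a a' : rho (a * a') = rho a *m rho a'.
  by apply: phi_ext => v; rewrite -mulmxA -!rhoE scalerA.
have rho_scal a : rho (scal a) = a%:M.
  by apply: phi_ext => v; rewrite -rhoE phiZ mul_scalar_mx.
have rho0 : rho 0 = 0.
  by apply: phi_ext => v; rewrite -rhoE scale0r phi0 mul0mx.
have rho_sum I (r : seq I) (P : pred I) a_ :
    rho (\sum_(i <- r | P i) a_ i) = \sum_(i <- r | P i) rho (a_ i).
  exact: (big_morph _ rhoD rho0).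
have rhoN a : rho (- a) = - rho a.
  by apply/eqP; rewrite -addr_eq0 -rhoD addNr rho0.
have [e homhe] := choice homh.
pose D : 'M[F]_N := diag_mx (\row_i (e i)%:R).
have rho_euler : rho (euler rH c alpha alphav theta) = D.
  apply/matrixP=> i j; rewrite mxE (euler_homogeneous (homhe j)) phiZ phi_delta.
  by rewrite !mxE andbT eq_sym; case: eqP => [->|]; rewrite ?mulr1 ?mulr0.
exists (fun g => \tr (rho (grp (subg W g)))) => psi psiS.
pose G g := rho (grp (subg W g)).
(* J is the matrix of the map V -> L in coordinates. *)
pose J : 'M[F]_(N, d) := \matrix_(i, j) phi (lowest (delta_mx 0 j)) i 0.
have phi_lowest v : phi (lowest v) = J *m v^T.
  rewrite {1}(row_sum_delta v) lowest_sum phi_sum; apply/colP=> i.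
  by rewrite summxE !mxE; apply: eq_bigr => j _; rewrite lowestZ phiZ !mxE mulrC.
have GJ g : g \in W -> G g *m J = J *m (rV g^-1%g)^T.
  move=> Wg; apply/trmx_inj/row_matrixP=> j; rewrite !rowE.
  rewrite -[delta_mx 0 j]trmxK -!trmx_mul -mulmxA -phi_lowest -rhoE grp_lowest.
  by rewrite subgK // phi_lowest -mulmxA -trmx_mul.
have J_inj : row_free J^T.
  rewrite -kermx_eq0; apply/negPn/negP => ker_neq0; have [v0 /eqP[]] := L_neq0.
  have modK : mxmodule rV (kermx J^T).
    apply/mxmoduleP=> g Wg; apply/sub_kermxP.
    have -> : kermx J^T *m rV g *m J^T = kermx J^T *m J^T *m (G g^-1%g)^T.
      by rewrite -!mulmxA -[in RHS]trmx_mul GJ ?groupV // invgK trmx_mul trmxK.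
    by rewrite mulmx_ker mul0mx.
  have [_ _ irr] := irrV.
  have /sub_kermxP := irr _ modK (submx1 _) ker_neq0; rewrite mul1mx => Jt0.
  have lowest_eq0 v : lowest v = 0.
    rewrite [lowest v]phi_h phi_lowest -[J]trmxK Jt0 trmx0 mul0mx.
    by rewrite big1 // => i _; rewrite mxE cher_scal0 scale0r.
  have homogeneous_eq0 k v : homogeneous k v -> v = 0.
    elim=> {k v} [v|k|k a u v _ -> _ ->|k x v _ ->] //.
      by rewrite scaler0 addr0.
    by rewrite scaler0.
  have [s_v hom_s ->] := all_graded v0; rewrite big_seq big1 // => u us.
  by have [k /homogeneous_eq0] := hom_s u us.
(* The projection P0 to degree 0 factors as J Q with Q J = 1, so the trace of g
   on degree 0 is its trace on V. *)
pose P0 : 'M[F]_N := diag_mx (\row_i (e i == 0%N)%:R).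
have P0J : P0 *m J = J.
  apply/matrixP=> i j; rewrite mul_diag_mx !mxE.
  have := euler_lowest (delta_mx 0 j) => /(congr1 phi); rewrite rhoE rho_euler phi0.
  move/colP/(_ i); rewrite mul_diag_mx !mxE => /eqP; rewrite mulf_eq0 pnatr_eq0.
  by case/orP=> [->|/eqP->]; rewrite ?mul1r ?mulr0.
have [Q P0E] : exists Q : 'M_(d, N), P0 = J *m Q.
  have /choice[q qE] : forall i, exists v, e i = 0%N -> h i = lowest v.
    move=> i; case: (e i) (homhe i) => [/homogeneous_lowestP[v ->]|k _]; first by exists v.
    by exists 0.
  exists (\matrix_(j, i) ((e i == 0%N)%:R * q i 0 j)).
  apply/matrixP=> i j; rewrite !mxE; transitivity ((e j == 0%N)%:R * phi (h j) i 0).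
    by rewrite phi_delta !mxE andbT; case: (i =P j) => [->|_]; rewrite ?mulr1 ?mulr0.
  under [RHS]eq_bigr do rewrite [X in _ * X]mxE.
  case: (e j) (qE j) => [/(_ erefl)->|k _] /=; last first.
    by rewrite mul0r big1 // => l _; rewrite mul0r mulr0.
  rewrite mul1r phi_lowest mxE; apply: eq_bigr => l _.
  by rewrite mul1r [_^T _ _]mxE.
have QJ : Q *m J = 1%:M.
  apply/trmx_inj/(row_free_inj J_inj); rewrite -!trmx_mul mulmxA -P0E P0J.
  by rewrite mulmx1.
have lowest_trace g : g \in W -> \sum_(i | e i == 0%N) G g i i = \tr (rV g^-1%g).
  move=> Wg; transitivity (\tr (G g *m P0)).
    rewrite [LHS]big_mkcond; apply: eq_bigr => i _ /=; rewrite mul_mx_diag !mxE.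
    by case: ifP; rewrite ?mulr1 ?mulr0.
  by rewrite P0E mulmxA GJ // -mulmxA mxtrace_mulC -mulmxA QJ mulmx1 mxtrace_tr.
under [RHS]eq_bigr => g Wg do rewrite -lowest_trace //.
have SW : [set s | is_reflection rH s] \subset W.
  by apply/subsetP=> s; rewrite inE => /andP[].
have sumS (V : nmodType) (E : gT -> V) :
    \sum_(s in [set s | is_reflection rH s]) E s = \sum_(s | is_reflection rH s) E s.
  by apply: eq_bigl => s; rewrite inE.
have reflW : {subset is_reflection rH <= W} by move=> s /andP[].
apply: (@trace_formula F gT W n rH [set s | is_reflection rH s] c alpha alphav
  SW _ N (fun x => rho (pos x)) (fun y => rho (mom y)) G e theta).
- by move=> s; rewrite inE => /reflE.
- move=> x; rewrite {1}cher_pos_delta rho_sum; apply: eq_bigr => i _.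
  by rewrite rhoM rho_scal mul_scalar_mx.
- by move=> g g' Wg Wg'; rewrite /G -rhoM -cher_grpM -subgM.
- by move=> g x Wg; rewrite /G -!rhoM cher_grp_pos subgK.
- move=> y x; rewrite -!rhoM cher_mom_pos rhoD addrC addKr rhoD rhoN rho_scal rho_sum sumS.
  congr (_ - _); rewrite -(sum_subg _ reflW); apply: eq_bigr => s _.
  by rewrite rhoM rho_scal mul_scalar_mx /G sgvalK.
- rewrite -/D -rho_euler /euler !rhoD rhoN !rho_sum rho_scal; congr (_ - _ + _).
    by apply: eq_bigr => j _; rewrite rhoM.
  rewrite sumS -(sum_subg _ reflW); apply: eq_bigr => s _.
  by rewrite rhoM rho_scal mul_scalar_mx /G sgvalK.
- by move=> x; rewrite -/D -rho_euler -!rhoM (euler_pos c reflE) rhoD addrC addKr.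
- by move=> g Wg; rewrite sumS; apply: psiS.
Qed.

End LowestWeightModule.

(** * Orthogonality of characters *)

Lemma mxtrace_idem (F : fieldType) n (P : 'M[F]_n) :
  P *m P = P -> \tr P = (\rank P)%:R.
Proof.
move=> PP; have RC : row_base P *m col_base P = 1%:M.
  apply: (row_free_inj (row_base_free P)).
  apply: (@row_full_inj _ _ _ _ (col_base P) (col_base_full P)).
  transitivity ((col_base P *m row_base P) *m (col_base P *m row_base P)).
    by rewrite !mulmxA.
  by rewrite mulmx_base PP mul1mx mulmx_base.
by rewrite -{1}(mulmx_base P) mxtrace_mulC RC mxtrace1.
Qed.

Lemma mxtrace_lin_mx (R : comNzRingType) m n
    (f : {linear 'M[R]_(m, n) -> 'M[R]_(m, n)}) :
  \tr (lin_mx f) = \sum_i \sum_j f (delta_mx i j) i j.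
Proof.
rewrite /mxtrace (reindex _ (curry_mxvec_bij _ _)) /= pair_bigA /=.
apply: eq_bigr => -[i j] _ /=.
have := congr1 (fun u : 'rV_(m * n) => u 0 (mxvec_index i j)) (mul_vec_lin f (delta_mx i j)).
by rewrite mxvecE mxvec_delta -rowE mxE.
Qed.

Lemma mxtrace_reprJ (F : fieldType) (gT : finGroupType) (G : {group gT}) n
    (rG : mx_representation F G n) g h :
  g \in G -> h \in G -> \tr (rG (g ^ h)%g) = \tr (rG g).
Proof.
move=> Gg Gh; rewrite conjgE !repr_mxM ?groupV ?groupM // mxtrace_mulC -mulmxA.
by rewrite -repr_mxM ?groupV // mulgV repr_mx1 mulmx1.
Qed.

Section Average.

Variables (F : numFieldType) (gT : finGroupType) (G : {group gT}) (n : nat).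
Variable rG : mx_representation F G n.

(** The projection A |-> |G|^-1 sum_g rG g^-1 A rG g of matrices to the
    centralizer of rG, as a matrix acting on the vectors mxvec A. *)
Definition average : 'M[F]_(n * n) := #|G|%:R^-1 *:
  \sum_(g in G) lin_mx (mulmxr (rG g) \o mulmx (rG g^-1%g)).

Lemma mul_average A : mxvec A *m average
  = mxvec (#|G|%:R^-1 *: \sum_(g in G) rG g^-1%g *m A *m rG g).
Proof.
rewrite -scalemxAr mulmx_sumr [RHS]linearZ /=; congr (_ *: _); rewrite linear_sum.
by apply: eq_bigr => g _; rewrite mul_vec_lin.
Qed.

Lemma natr_card_neq0 : #|G|%:R != 0 :> F.
Proof. by rewrite pnatr_eq0 -lt0n cardG_gt0. Qed.

Lemma average_cent A : centgmx rG A -> mxvec A *m average = mxvec A.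
Proof.
move=> /centgmxP cA; rewrite mul_average (eq_bigr (fun=> A)) => [|g Gg].
  by rewrite sumr_const -scaler_nat scalerA mulVf ?scale1r // natr_card_neq0.
by rewrite -mulmxA cA // mulmxA -repr_mxM ?groupV // mulVg repr_mx1 mul1mx.
Qed.

Lemma cent_average A : centgmx rG (vec_mx (mxvec A *m average)).
Proof.
rewrite mul_average mxvecK; apply/centgmxP=> h Gh.
rewrite -scalemxAl -scalemxAr; congr (_ *: _).
rewrite mulmx_suml mulmx_sumr [RHS](reindex_inj (mulIg h)) /=.
apply: eq_big => g; first by rewrite groupMr.
move=> Gg; rewrite invMg !repr_mxM ?groupV // !mulmxA.
by rewrite -[rG h *m rG h^-1%g]repr_mxM ?groupV // mulgV repr_mx1 mul1mx.
Qed.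

Lemma average_idem : average *m average = average.
Proof.
apply/row_matrixP=> i; rewrite row_mul rowE.
by have := average_cent (cent_average (vec_mx (delta_mx 0 i))); rewrite !vec_mxK.
Qed.

(** The dimension of the centralizer is the trace of an idempotent, and the trace
    of A |-> rG g^-1 A rG g is the product of two traces. For the Specht modules
    only the integrality of this norm matters. *)
Lemma char_norm : \sum_(g in G) \tr (rG g) * \tr (rG g^-1%g)
  = #|G|%:R * (\rank average)%:R.
Proof.
rewrite -(mxtrace_idem average_idem) /average mxtraceZ mulrA mulfV ?natr_card_neq0 //.
rewrite mul1r raddf_sum /=; apply: eq_bigr => g Gg; rewrite mxtrace_lin_mx.
rewrite mulrC /mxtrace mulr_suml; apply: eq_bigr => i _; rewrite mulr_sumr.
apply: eq_bigr => j _ /=.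
rewrite mxE (bigD1 j) //= big1 ?addr0 => [|k /negbTE kj].
  rewrite mxE (bigD1 i) //= big1 ?addr0 => [|l /negbTE li]; rewrite !mxE ?eqxx ?mulr1 //.
  by rewrite li mulr0.
by rewrite mxE big1 ?mul0r // => l _; rewrite !mxE kj andbF mulr0.
Qed.

Lemma cent_scalar A : \rank average = 1%N -> centgmx rG A -> is_scalar_mx A.
Proof.
move=> rk1 cA; have [n0|n_gt0] := posnP n.
  by apply/is_scalar_mxP; exists 0; apply/matrixP=> i; have:= ltn_ord i; rewrite {2}n0.
have c1 : centgmx rG 1%:M by apply/centgmxP=> g _; rewrite mul1mx mulmx1.
have le1 : (mxvec (1%:M : 'M[F]_n) <= average)%MS.
  by rewrite -(average_cent c1) submxMl.
have : (mxvec A <= mxvec (1%:M : 'M[F]_n))%MS.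
  rewrite (submx_trans _ (_ : average <= _)%MS) //.
    by rewrite -(average_cent cA) submxMl.
  rewrite -(geq_leqif (mxrank_leqif_sup le1)) rk1 lt0n mxrank_eq0 mxvec_eq0.
  by apply/eqP=> /matrixP/(_ (Ordinal n_gt0) (Ordinal n_gt0))/eqP; rewrite !mxE eqxx oner_eq0.
case/sub_rVP=> a Aa; apply/is_scalar_mxP; exists a.
by apply: (can_inj mxvecK); rewrite Aa -linearZ scalemx1.
Qed.

End Average.

Section Schur.

Variables (F : fieldType) (gT : finGroupType) (G : {group gT}) (m n : nat).
Variables (rX : mx_representation F G m) (rY : mx_representation F G n).
Hypotheses (irrX : mx_irreducible rX) (irrY : mx_irreducible rY).

Lemma intertwiner_eq0 (A : 'M[F]_(m, n)) :
    (forall g, g \in G -> rX g *m A = A *m rY g) -> ~ mx_rsim rX rY -> A = 0.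
Proof.
move=> homA nsim; apply/eqP/negPn/negP=> A_neq0; apply: nsim.
have freeA : row_free A.
  rewrite -kermx_eq0; apply/negPn/negP=> K_neq0; case/negP: A_neq0.
  have modK : mxmodule rX (kermx A).
    apply/mxmoduleP=> g Gg; apply/sub_kermxP.
    by rewrite -mulmxA homA // mulmxA mulmx_ker mul0mx.
  have [_ _ irr] := irrX; have /sub_kermxP := irr _ modK (submx1 _) K_neq0.
  by rewrite mul1mx => ->.
have fullA : row_full A.
  have modA : mxmodule rY (<<A>>%MS : 'M_n).
    apply/mxmoduleP=> g Gg.
    by rewrite (eqmxMr _ (genmxE _)) genmxE -homA // submxMl.
  have [_ _ irr] := irrY; have := irr _ modA (submx1 _).
  by rewrite genmxE sub1mx -mxrank_eq0 genmxE mxrank_eq0; apply.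
exists A => //; by rewrite -(eqP freeA) (eqP fullA).
Qed.

(** The sums of rX g^-1 E rY g over g, for E an elementary matrix, intertwine rX
    and rY, hence vanish. *)
Lemma char_ortho : ~ mx_rsim rX rY -> \sum_(g in G) \tr (rX g^-1%g) *: rY g = 0.
Proof.
move=> nsim; pose S i k : 'M[F]_(m, n) := \sum_(g in G) rX g^-1%g *m delta_mx i k *m rY g.
have S0 i k : S i k = 0.
  apply: intertwiner_eq0 nsim => h Gh; rewrite /S mulmx_sumr mulmx_suml.
  rewrite [LHS](reindex_inj (mulIg h)) /=; apply: eq_big => g; first by rewrite groupMr.
  rewrite groupMr // => Gg; rewrite invMg !repr_mxM ?groupV // !mulmxA.
  by rewrite -repr_mxM ?groupV // mulgV repr_mx1 mul1mx.
apply/matrixP=> k l; rewrite summxE mxE.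
transitivity (\sum_i S i k i l); last by rewrite big1 // => i _; rewrite S0 mxE.
under [RHS]eq_bigr do rewrite summxE.
rewrite exchange_big /=; apply: eq_bigr => g Gg; rewrite mxE mulr_suml.
apply: eq_bigr => i _; rewrite mxE (bigD1 k) //= big1 ?addr0 => [|j /negbTE jk].
  rewrite mxE (bigD1 i) //= big1 ?addr0 => [|j /negbTE ji]; first by rewrite !mxE ?eqxx ?mulr1.
  by rewrite !mxE ji mulr0.
by rewrite mxE big1 ?mul0r // => i' _; rewrite !mxE jk andbF mulr0.
Qed.
Lemma char_ortho_trace :
  ~ mx_rsim rX rY -> \sum_(g in G) \tr (rX g^-1%g) * \tr (rY g) = 0.
Proof.
move=> nsim; transitivity (\tr (\sum_(g in G) \tr (rX g^-1%g) *: rY g)).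
  by rewrite [RHS]raddf_sum; apply: eq_bigr => g _; rewrite /= mxtraceZ.
by rewrite (char_ortho nsim) mxtrace0.
Qed.

End Schur.

(** By Schur's lemma the centralizer consists of the scalar matrices. *)
Lemma char_irr_norm (F : numClosedFieldType) (gT : finGroupType) (G : {group gT}) n
    (rG : mx_representation F G n) :
  mx_irreducible rG -> \sum_(g in G) \tr (rG g) * \tr (rG g^-1%g) = #|G|%:R.
Proof.
move=> irrG; rewrite char_norm -[RHS]mulr1; congr (_ * _).
have absG := group_closure_closed_field irrG.
have [n_gt0 _] : (0 < n)%N /\ _ := proj1 (mx_irrP rG) irrG.
suff -> : \rank (average rG) = 1%N by [].
have c1 : centgmx rG 1%:M by apply/centgmxP=> g _; rewrite mul1mx mulmx1.
apply/eqP; rewrite eqn_leq lt0n mxrank_eq0; apply/andP; split.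
  rewrite (leq_trans _ (rank_leq_row (mxvec (1%:M : 'M[F]_n)))) //; apply: mxrankS.
  apply/row_subP=> i; rewrite rowE -[delta_mx 0 i]vec_mxK -[X in (X <= _)%MS]vec_mxK.
  have /is_scalar_mxP[a ->] := mx_abs_irr_cent_scalar absG (cent_average rG (vec_mx 'e_i)).
  have -> : mxvec a%:M = a *: mxvec (1%:M : 'M[F]_n) by rewrite -linearZ scalemx1.
  exact: scalemx_sub.
apply/eqP=> avg0; have := average_cent c1; rewrite avg0 mulmx0 => /esym/eqP.
rewrite mxvec_eq0 => /eqP/matrixP/(_ (Ordinal n_gt0) (Ordinal n_gt0))/eqP.
by rewrite !mxE eqxx oner_eq0.
Qed.

(** * Splitting over a subgroup of index two *)

Section ConjugateRepresentation.

Variables (F : fieldType) (gT : finGroupType) (D : {group gT}) (n : nat).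
Variables (rD : mx_representation F D n) (s : gT).
Hypothesis nDs : s \in 'N(D).

Lemma conjg_mx_repr : mx_repr D (fun g => rD (g ^ s)%g).
Proof.
split=> [|g h Dg Dh]; first by rewrite conj1g repr_mx1.
by rewrite conjMg repr_mxM // memJ_norm.
Qed.

Definition conjg_repr := MxRepresentation conjg_mx_repr.

Lemma conjg_repr_irr : mx_irreducible rD -> mx_irreducible conjg_repr.
Proof.
case/mx_irrP=> n_gt0 irr; apply/mx_irrP; split=> // U modU U_neq0.
apply: irr U_neq0; apply/mxmoduleP=> g Dg.
have /mxmoduleP/(_ (g ^ s^-1)%g) := modU.
by rewrite /= conjgKV; apply; rewrite memJ_norm ?groupV.
Qed.

End ConjugateRepresentation.

Lemma mx_rsim_trace (F : fieldType) (gT : finGroupType) (G : {group gT}) m n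
    (rX : mx_representation F G m) (rY : mx_representation F G n) g :
  mx_rsim rX rY -> g \in G -> \tr (rX g) = \tr (rY g).
Proof.
case/mx_rsim_def=> B [B' B'B homB] Gg.
by rewrite homB // mxtrace_mulC mulmxA B'B mul1mx.
Qed.

(** A representation V of B whose character vanishes off the subgroup D of
    index two and has norm a square k ^ 2, and whose restriction to D is the sum
    of two irreducible representations Vp and Vm with characters p and q. *)
Section IndexTwo.

Variables (F : numClosedFieldType) (gT : finGroupType) (B D : {group gT}) (s : gT).
Hypotheses (sDB : D \subset B) (Bs : s \in B) (nDs : s \in 'N(D)).
Hypothesis coset2 : {in B, forall b, b \notin D -> (b * s^-1)%g \in D}.
Hypothesis cardB : #|B| = (2 * #|D|)%N.
Variables (d : nat) (V : mx_representation F B d).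
Variables (dp : nat) (Vp : mx_representation F D dp).
Variables (dm : nat) (Vm : mx_representation F D dm).
Hypotheses (irrVp : mx_irreducible Vp) (irrVm : mx_irreducible Vm).
Hypothesis simV : mx_rsim (subg_repr V sDB)
  (dadd_grepr (Representation Vp) (Representation Vm)).
Hypothesis trV0 : {in B, forall g, g \notin D -> \tr (V g) = 0}.
Variable k : nat.
Hypothesis normV : \sum_(g in B) \tr (V g) * \tr (V g^-1%g) = #|B|%:R * (k ^ 2)%:R.

Let p g := \tr (Vp g).
Let q g := \tr (Vm g).

Lemma sum_invg (E : gT -> F) : \sum_(g in D) E g^-1%g = \sum_(g in D) E g.
Proof.
by rewrite [RHS](reindex_inj invg_inj); apply: eq_bigl => g; rewrite groupV.
Qed.

Let trV g : g \in D -> \tr (V g) = p g + q g.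
Proof. by move=> Dg; rewrite -[V g]/(subg_repr V sDB g) (mx_rsim_trace simV) //= mxtrace_block. Qed.

Let normVD : \sum_(g in D) (p g + q g) * (p g^-1%g + q g^-1%g) = #|D|%:R * (2 * k ^ 2)%:R.
Proof.
rewrite natrM mulrA -natrM mulnC -cardB -normV.
rewrite [RHS](big_setID D) /= (setIidPr sDB) [X in _ + X]big1 => [|g].
  by rewrite addr0; apply: eq_bigr => g Dg; rewrite !trV ?groupV.
by rewrite inE => /andP[Dg Bg]; rewrite trV0 // mul0r.
Qed.

(** The norm of V over D is 2 k ^ 2. It is 4 if Vp and Vm are isomorphic and 2
    otherwise, and 2 is not a square. *)
Lemma constituents_neq : ~ mx_rsim Vp Vm /\ k = 1%N.
Proof.
have cardD0 : #|D|%:R != 0 :> F by apply: natr_card_neq0.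
have E : \sum_(g in D) (p g + q g) * (p g^-1%g + q g^-1%g)
   = #|D|%:R *+ 2 + (\sum_(g in D) p g^-1%g * q g) *+ 2.
  rewrite (eq_bigr (fun g => p g * p g^-1%g + q g * q g^-1%g + p g^-1%g * q g
     + p g^-1%g^-1%g * q g^-1%g)); last by move=> g _; rewrite invgK; ring.
  by rewrite !big_split /= !char_irr_norm // (sum_invg (fun g => p g^-1%g * q g)) mulr2n; ring.
have := normVD; rewrite E.
have [sim|nsim] := EM (mx_rsim Vp Vm).
  rewrite (_ : \sum_(g in D) _ = #|D|%:R); last first.
    rewrite -(char_irr_norm irrVp); apply: eq_bigr => g Dg.
    by rewrite mulrC /q -(mx_rsim_trace sim).
  rewrite -mulrnDr -[_ *+ (2 + 2)]mulr_natr => e; have /eqP := mulfI cardD0 e; rewrite eqr_nat.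
  by move/eqP; case: k => [|[|j]] //; nia.
rewrite (char_ortho_trace irrVp irrVm nsim).
rewrite mul0rn addr0 -[_ *+ 2]mulr_natr => e; have /eqP := mulfI cardD0 e; rewrite eqr_nat.
by move/eqP=> k2; split=> //; nia.
Qed.

(** The conjugate of Vp by s is not isomorphic to Vp. Otherwise the sum f of the
    p (g^-1) g over D would be invariant under conjugation by B, and would act on
    V as a matrix commuting with B. As V has norm 1, this matrix would be scalar;
    but it vanishes on Vm and its trace is |D|. *)
Lemma conjg_char_ortho : \sum_(g in D) p g^-1%g * p (g ^ s)%g = 0.
Proof.
have cardD0 : #|D|%:R != 0 :> F by apply: natr_card_neq0.
have [nsim k1] := constituents_neq.
have irrVs := conjg_repr_irr nDs irrVp.
have [sim_s|nsim_s] := EM (mx_rsim Vp (conjg_repr Vp nDs)); last first.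
  exact: char_ortho_trace irrVp irrVs nsim_s.
have p_s g : g \in D -> p (g ^ s)%g = p g.
  by move=> Dg; rewrite [RHS](mx_rsim_trace sim_s Dg).
have p_D g h : g \in D -> h \in D -> p (g ^ h)%g = p g by apply: mxtrace_reprJ.
have p_B g b : g \in D -> b \in B -> p (g ^ b)%g = p g.
  move=> Dg Bb; have [/(p_D g b Dg)//|nDb] := boolP (b \in D).
  rewrite -[b](mulgKV s) conjgM p_s ?p_D ?coset2 // memJ_norm //.
  by rewrite (subsetP (normG D)) ?coset2.
have nDB b g : b \in B -> (g ^ b \in D)%g = (g \in D).
  move=> Bb; rewrite memJ_norm //; have [/(subsetP (normG D))//|nDb] := boolP (b \in D).
  by rewrite -[b](mulgKV s) groupM // (subsetP (normG D)) ?coset2.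
pose f := \sum_(g in D) p g^-1%g *: V g.
have cent_f : centgmx V f.
  apply/centgmxP=> b Bb; rewrite mulmx_sumr mulmx_suml.
  rewrite [RHS](reindex_inj (conjg_inj b)); apply: eq_big => [g|g Dg]; first by rewrite nDB.
  have Bg := subsetP sDB g Dg; rewrite -scalemxAl -scalemxAr -conjVg p_B ?groupV //.
  by rewrite -!repr_mxM ?groupJ // -conjgC.
have rk1 : \rank (average V) = 1%N.
  apply/eqP; rewrite -(eqr_nat F); apply/eqP/(mulfI (natr_card_neq0 F B)).
  by rewrite -char_norm normV k1.
have /is_scalar_mxP[a fa] := cent_scalar rk1 cent_f.
have tr_f : \tr f = #|D|%:R.
  rewrite raddf_sum /= -[RHS](char_irr_norm irrVp).
  rewrite -[RHS]addr0 -[X in _ + X](char_ortho_trace irrVp irrVm nsim) -big_split.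
  apply: eq_bigr => g Dg.
  by rewrite /= mxtraceZ trV // mulrDr [\tr _ * \tr _]mulrC.
case: (mx_rsim_def simV) => M [M' M'M simM].
have blk_f : block_mx (\sum_(g in D) p g^-1%g *: Vp g) 0 0 0 = a%:M :> 'M_(dp + dm).
  transitivity (M' *m f *m M); last first.
    by rewrite fa mul_mx_scalar -scalemxAl M'M scalemx1.
  rewrite mulmx_sumr mulmx_suml.
  transitivity (block_mx (\sum_(g in D) p g^-1%g *: Vp g) 0 0
                         (\sum_(g in D) p g^-1%g *: Vm g)).
    by rewrite (char_ortho irrVp irrVm nsim).
  transitivity (\sum_(g in D) p g^-1%g *: block_mx (Vp g) 0 0 (Vm g)).
    elim/big_rec3: _ => [|g ? ? ? _ <-]; first by rewrite block_mx0.
    by rewrite scale_block_mx add_block_mx !scaler0 !addr0.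
  apply: eq_bigr => g Dg; rewrite -scalemxAr -scalemxAl; congr (_ *: _).
  by rewrite -[V g]/(subg_repr V sDB g) simM //= !mulmxA M'M mul1mx -mulmxA M'M mulmx1.
have [n_gt0 _] : (0 < dm)%N /\ _ := proj1 (mx_irrP Vm) irrVm.
have a0 : a = 0.
  have := congr1 (fun A => drsubmx A (Ordinal n_gt0) (Ordinal n_gt0)) blk_f.
  by rewrite block_mxKdr !mxE eqxx.
by move: tr_f; rewrite fa a0 mxtrace_scalar mul0rn => /esym/eqP; rewrite (negbTE cardD0).
Qed.

End IndexTwo.

Lemma dadd_greprC (F : fieldType) (gT : finGroupType) (G : {group gT})
    (rX rY : representation F G) :
  mx_rsim (dadd_grepr rX rY) (dadd_grepr rY rX).
Proof.
exists (block_mx 0 1%:M 1%:M 0); first exact: addnC.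
  apply/row_freeP; exists (block_mx 0 1%:M 1%:M 0).
  by rewrite mulmx_block !(mulmx0, mul0mx, mulmx1, add0r, addr0) -scalar_mx_block.
by move=> g _; rewrite /= !mulmx_block !(mulmx0, mul0mx, mulmx1, mul1mx, add0r, addr0).
Qed.

(** * Induced characters *)

(** The C i are the blocks of the inverse of the matrix made of the A i. *)
Lemma direct_sum_coords (F : fieldType) (I : finType) (P : pred I) e d
    (A : I -> 'M[F]_(e, d)) :
    (forall i, P i -> row_free (A i)) ->
    (\sum_(i | P i) <<A i>> :=: 1%:M)%MS -> mxdirect (\sum_(i | P i) <<A i>>) ->
  exists C : I -> 'M[F]_(d, e), \sum_(i | P i) C i *m A i = 1%:M /\
    forall i j, P i -> P j -> A j *m C i = if j == i then 1%:M else 0.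
Proof.
move=> freeA sumA /mxdirect_sumsP dirA.
pose T i := (\sum_(j | P j && (j != i)) <<A j>>)%MS.
pose pr i := proj_mx <<A i>>%MS (T i).
have pr_id i M : P i -> (M <= <<A i>>)%MS -> M *m pr i = M :> 'M_(_, d).
  by move=> Pi; apply/proj_mx_id/dirA.
have pr_0 i j M : P i -> P j -> j != i -> (M <= <<A j>>)%MS -> M *m pr i = 0 :> 'M_(_, d).
  move=> Pi Pj ji leM; apply/proj_mx_0; first exact: dirA.
  by rewrite (submx_trans leM) // (sumsmx_sup j) ?Pj.
exists (fun i => pr i *m pinvmx (A i)); split=> [|i j Pi Pj].
  transitivity (\sum_(i | P i) pr i).
    apply: eq_bigr => i _; rewrite mulmxKpV // -(genmxE (A i)).
    by rewrite -[pr i]mul1mx proj_mx_sub.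
  have /sub_sumsmxP[u u1] : ((1%:M : 'M[F]_d) <= \sum_(i | P i) <<A i>>)%MS by rewrite sumA.
  rewrite -[LHS]mul1mx {1}u1 u1 mulmx_suml; apply: eq_bigr => j Pj.
  rewrite mulmx_sumr (bigD1 j) //= pr_id ?submxMl // big1 ?addr0 // => i /andP[Pi ij].
  by apply: (pr_0 _ i j); rewrite ?submxMl // eq_sym.
rewrite mulmxA; case: eqP => [->|/eqP ji]; last by rewrite (pr_0 _ i j) ?genmxE ?mul0mx.
by rewrite pr_id ?genmxE // mulmxVp // freeA.
Qed.

Section InducedCharacter.

Variables (F : fieldType) (gT kT : finGroupType) (G : {group gT}) (K : {group kT}).
Variables (phi : kT -> gT) (e d : nat).
Variables (rW : mx_representation F K e) (rV : mx_representation F G d).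
Hypothesis phiM : {in K &, {morph phi : x y / (x * y)%g}}.
Hypothesis phi_inj : {in K &, injective phi}.
Hypothesis phiG : {in K, forall x, phi x \in G}.

(** The character of rW, transported to the image of phi and extended by zero. *)
Definition ext_char (g : gT) : F := \sum_(x in K | phi x == g) \tr (rW x).

Lemma ext_charE x : x \in K -> ext_char (phi x) = \tr (rW x).
Proof.
move=> Kx; rewrite /ext_char (bigD1 x) ?Kx ?eqxx //= big1 ?addr0 // => y.
by case/andP=> /andP[Ky /eqP/phi_inj->]; rewrite ?eqxx.
Qed.

Lemma ext_char_out g : g \notin phi @: K -> ext_char g = 0.
Proof.
move=> nKg; apply: big1 => x /andP[Kx /eqP gE]; case/negP: nKg.
by rewrite -gE imset_f.
Qed.

Let f := Morphism phiM.
Let H : {group gT} := (f @* K)%G.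

Let imHE : phi @: K = H.
Proof. by rewrite /= morphimEdom. Qed.

Let sHG : H \subset G.
Proof. by rewrite -imHE; apply/subsetP=> _ /imsetP[x Kx ->]; apply: phiG. Qed.

Lemma ext_charJ x g : x \in K -> ext_char (phi x * g * (phi x)^-1)%g = ext_char g.
Proof.
move=> Kx; have [|ng] := boolP (g \in phi @: K).
  case/imsetP=> y Ky ->; rewrite -[(phi x)^-1%g](morphV f) //= -!phiM ?groupM ?groupV //.
  rewrite !ext_charE ?groupM ?groupV // !repr_mxM ?groupM ?groupV //.
  by rewrite mxtrace_mulC mulmxA -repr_mxM ?groupV // mulVg repr_mx1 mul1mx.
rewrite !ext_char_out //; apply: contra ng; rewrite imHE => Hg.
have Hx : phi x \in H by rewrite -imHE imset_f.
by move: Hg; rewrite groupMr ?groupV // groupMl.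
Qed.

(** The element g permutes the translates of the copy of rW, and the trace sees
    only those that it fixes. Summing over G instead of over the cosets of the
    image of K multiplies the sum by |K|. *)
Theorem induced_char g : induced_along phi rW rV -> g \in G ->
  #|K|%:R * \tr (rV g) = \sum_(x in G) ext_char (x * g * x^-1)%g.
Proof.
case=> A [freeA homA sumA dirA] Gg.
have reprG X : X \in rcosets (phi @: K) G -> repr X \in G.
  case/rcosetsP=> x Gx ->; have := mem_repr_rcoset H x; rewrite -imHE => /rcosetP[y].
  by rewrite imHE => Hy ->; rewrite groupM // (subsetP sHG).
have freeAX X : X \in rcosets (phi @: K) G -> row_free (A *m rV (repr X)).
  move=> /reprG GX; rewrite /row_free mxrankMfree ?(eqP freeA) // row_free_unit.
  exact: repr_mx_unit.
have [C [sumC AC]] := direct_sum_coords freeAX sumA dirA.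
transitivity (\sum_(X in rcosets (phi @: K) G)
  #|K|%:R * ext_char (repr X * g * (repr X)^-1)%g).
  rewrite -mulr_sumr; congr (_ * _).
  rewrite -[rV g]mul1mx -sumC mulmx_suml raddf_sum /=; apply: eq_bigr => X PX.
  have [x0 Gx0 XE] := imsetP PX; rewrite rcosetE imHE in XE.
  have XrE : X = H :* repr X by rewrite XE rcoset_repr.
  pose Y := H :* (repr X * g).
  have PY : Y \in rcosets (phi @: K) G.
    by apply/rcosetsP; exists (repr X * g)%g; rewrite ?groupM ?reprG // imHE.
  have [k Kk gE] : exists2 k, k \in K & (repr X * g = phi k * repr Y)%g.
    have /rcosetP[h] : (repr X * g)%g \in H :* repr Y by rewrite rcoset_repr rcoset_refl.
    by rewrite -imHE => /imsetP[k Kk ->] ->; exists k.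
  have -> : \tr (C X *m (A *m rV (repr X)) *m rV g) = \tr (if Y == X then rW k else 0).
    rewrite -mulmxA mxtrace_mulC -(mulmxA A) -repr_mxM ?reprG // gE.
    rewrite repr_mxM ?phiG ?reprG // (mulmxA A) -homA // -!mulmxA (mulmxA A) AC //.
    by case: eqP; rewrite ?mulmx1 ?mulmx0.
  rewrite gE; case: eqP => [->|/eqP YX]; first by rewrite mulgK ext_charE.
  rewrite mxtrace0 ext_char_out // -mulgA imHE groupMl -?imHE ?imset_f // imHE.
  apply: contra YX; rewrite -mem_rcoset => /rcoset_eqP.
  by rewrite rcoset_repr -XrE -/Y => ->.
rewrite [RHS](set_partition_big _ (rcosets_partition sHG)) /= -imHE.
apply: eq_bigr => X PX; have [x0 Gx0 XE] := imsetP PX; rewrite rcosetE imHE in XE.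
have XrE : X = H :* repr X by rewrite XE rcoset_repr.
have cardX : #|X| = #|K|.
  by rewrite XE card_rcoset -imHE card_in_imset.
rewrite -cardX -sum1_card natr_sum mulr_suml; apply: eq_bigr => x.
rewrite {1}XrE => /rcosetP[h]; rewrite -imHE => /imsetP[k Kk ->] ->.
by rewrite mul1r invMg -(ext_charJ _ Kk) !mulgA.
Qed.

Lemma ext_char_mull x a g : x \in K -> rW x = a%:M ->
  ext_char (phi x * g)%g = a * ext_char g.
Proof.
move=> Kx rWx; have [|ng] := boolP (g \in phi @: K).
  case/imsetP=> y Ky ->; rewrite -phiM // !ext_charE ?groupM // repr_mxM // rWx.
  by rewrite mul_scalar_mx mxtraceZ.
rewrite !ext_char_out ?mulr0 //; apply: contra ng; rewrite imHE groupMl //.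
by rewrite -imHE imset_f.
Qed.

Lemma ext_char_mulr x a g : x \in K -> rW x = a%:M ->
  ext_char (g * phi x)%g = a * ext_char g.
Proof.
move=> Kx rWx; have [|ng] := boolP (g \in phi @: K).
  case/imsetP=> y Ky ->; rewrite -phiM // !ext_charE ?groupM // repr_mxM // rWx.
  by rewrite mul_mx_scalar mxtraceZ.
rewrite !ext_char_out ?mulr0 //; apply: contra ng; rewrite imHE groupMr //.
by rewrite -imHE imset_f.
Qed.

(** Mackey's criterion. The norm is a sum over y in G of the sums S y of the
    products of the character at g and at y g^-1 y^-1. The elements y of the
    image of K all contribute S 1, which is the norm of rW. For the other y the
    assumption provides an element acting by a scalar a whose conjugate by y acts
    by another scalar a'; translation by this element gives a' S y = a S y, so
    that S y = 0. *)
Theorem induced_norm : induced_along phi rW rV ->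
  #|K|%:R != 0 :> F ->
  (forall y, y \in G -> y \notin phi @: K -> exists x x' a a',
    [/\ x \in K, x' \in K, rW x = a%:M, rW x' = a'%:M & a != a'
      /\ (y * phi x * y^-1 = phi x')%g]) ->
  #|K|%:R * \sum_(g in G) \tr (rV g) * \tr (rV g^-1%g)
  = #|G|%:R * \sum_(x in K) \tr (rW x) * \tr (rW x^-1%g).
Proof.
move=> indV cardK0 mackey; apply: (mulfI cardK0).
pose S y := \sum_(g in G) ext_char g * ext_char (y * g^-1 * y^-1)%g.
have S_out y : y \in G -> y \notin phi @: K -> S y = 0.
  move=> Gy nKy; have [x [x' [a [a' [Kx Kx' rWx rWx' [aa' yx]]]]]] := mackey y Gy nKy.
  have : a' * S y = a * S y.
    rewrite /S [in LHS](reindex_inj (mulIg (phi x))) /= !mulr_sumr.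
    apply: eq_big => g; rewrite groupMr ?phiG // => Gg.
    rewrite (ext_char_mulr _ Kx rWx) mulrCA -mulrA; congr (_ * (_ * _)).
    rewrite -(ext_char_mull _ Kx' rWx') -yx; congr ext_char.
    by rewrite invMg !mulgA mulgKV mulgK.
  move/eqP; rewrite -subr_eq0 -mulrBl mulf_eq0 subr_eq0 eq_sym (negPf aa').
  by move/eqP.
have S_in y : y \in phi @: K -> S y = S 1%g.
  case/imsetP=> k Kk ->; apply: eq_bigr => g _.
  by rewrite ext_charJ // mul1g invg1 mulg1.
have S1 : S 1%g = \sum_(x in K) \tr (rW x) * \tr (rW x^-1%g).
  rewrite /S (big_setID (phi @: K)) /= [X in _ + X]big1 => [|g]; last first.
    by rewrite inE => /andP[ng _]; rewrite ext_char_out ?mul0r.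
  rewrite addr0 imHE (setIidPr sHG) -imHE big_imset //=; apply: eq_bigr => x Kx.
  by rewrite mul1g invg1 mulg1 -[(phi x)^-1%g](morphV f) //= !ext_charE ?groupV.
rewrite mulrA -S1; transitivity (\sum_(g in G) \sum_(x in G) \sum_(y in G)
    ext_char (x * g * x^-1)%g * ext_char (y * g^-1 * y^-1)%g).
  rewrite mulr_sumr; apply: eq_bigr => g Gg.
  rewrite mulrACA induced_char // induced_char ?groupV // mulr_suml.
  by apply: eq_bigr => x _; rewrite mulr_sumr.
rewrite exchange_big /=; transitivity (\sum_(x in G) \sum_(y in G) S y).
  apply: eq_bigr => x Gx; rewrite exchange_big /= (reindex_inj (mulIg x)) /=.
  apply: eq_big => [y|y]; rewrite groupMr // => Gy.
  rewrite (reindex_inj (conjg_inj x)) /=; apply: eq_big => [g|g _]; first by rewrite groupJr.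
  rewrite -conjVg !conjgE !mulgA; congr (ext_char _ * ext_char _).
    by rewrite !(mulgV, mul1g, mulgK).
  by rewrite invMg !mulgA !mulgK.
rewrite [LHS]sumr_const -[LHS]mulr_natl mulrCA; congr (_ * _).
rewrite (big_setID (phi @: K)) /= [X in _ + X]big1 => [|y]; last first.
  by rewrite inE => /andP[ny Gy]; rewrite S_out.
rewrite addr0 imHE (setIidPr sHG) -imHE (eq_bigr (fun=> S 1%g)) => [|y]; last first.
  by move/S_in.
by rewrite sumr_const card_in_imset // mulr_natl.
Qed.

End InducedCharacter.

(** * Block subgroups of the signed permutations *)

Lemma signed_perm_eq n (f g : signed_perm n) :
  (forall i, f.1 i = g.1 i /\ f.2 i = g.2 i) -> f = g.
Proof.
case: f g => [s a] [t b] fg; congr (_, _); first by apply/permP=> i; case: (fg i).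
by apply/ffunP=> i; case: (fg i).
Qed.

Lemma signed_permM1 n (g h : signed_perm n) i : (g * h)%g.1 i = h.1 (g.1 i).
Proof. exact: permM. Qed.

Lemma signed_permM2 n (g h : signed_perm n) i :
  (g * h)%g.2 i = g.2 i (+) h.2 (g.1 i).
Proof. exact: ffunE. Qed.

Lemma signed_permV1 n (g : signed_perm n) i : (g^-1)%g.1 i = (g.1^-1)%g i.
Proof. by []. Qed.

Lemma signed_permV2 n (g : signed_perm n) i : (g^-1)%g.2 i = g.2 ((g.1^-1)%g i).
Proof. exact: ffunE. Qed.

Definition signed_permE := (signed_permM1, signed_permM2, signed_permV1, signed_permV2).

Lemma sign_changesE n (g : signed_perm n) : sign_changes g = (\sum_i g.2 i)%N.
Proof.
rewrite /sign_changes -sum1_card big_mkcond; apply: eq_bigr => i _.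
by rewrite inE; case: (g.2 i).
Qed.

Lemma odd_sign_changesV n (g : signed_perm n) :
  odd (sign_changes g^-1%g) = odd (sign_changes g).
Proof.
have := odd_sign_changesM g g^-1%g; rewrite mulgV sign_changes1.
by case: (odd (sign_changes g)); case: (odd (sign_changes g^-1%g)).
Qed.

Section Blocks.

Variables (la : seq nat * seq nat) (n : nat) (n12 : (sumn la.1 + sumn la.2)%N = n).
Local Notation n1 := (sumn la.1).
Local Notation n2 := (sumn la.2).
Local Notation kT := (signed_perm n1 * signed_perm n2)%type.
Local Notation phi := (block_embed n12).

(** The coordinates permuted by the first and by the second factor. *)
Definition lo (i : 'I_n1) : 'I_n := cast_ord n12 (lshift n2 i).
Definition hi (i : 'I_n2) : 'I_n := cast_ord n12 (rshift n1 i).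

Variant block_spec : 'I_n -> Type :=
| BlockLo j : block_spec (lo j)
| BlockHi k : block_spec (hi k).

Lemma blockP i : block_spec i.
Proof.
rewrite -(cast_ordKV n12 i); case: (split_ordP (cast_ord (esym n12) i)) => j ->.
  exact: BlockLo.
exact: BlockHi.
Qed.

Lemma lo_inj : injective lo.
Proof. by move=> i j /cast_ord_inj/lshift_inj. Qed.

Lemma hi_inj : injective hi.
Proof. by move=> i j /cast_ord_inj/rshift_inj. Qed.

Lemma leq_lo j : (n1 <= lo j)%N = false.
Proof. by rewrite leqNgt /= ltn_ord. Qed.

Lemma leq_hi k : (n1 <= hi k)%N.
Proof. exact: leq_addr. Qed.

Lemma lo_hi j k : (lo j == hi k) = false.
Proof. by apply/eqP => jk; have := leq_hi k; rewrite -jk leq_lo. Qed.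

Lemma hi_lo j k : (hi k == lo j) = false.
Proof. by rewrite eq_sym lo_hi. Qed.

Let split_lo j : split (cast_ord (esym n12) (lo j)) = inl j.
Proof. by rewrite /lo cast_ordK (unsplitK (inl j)). Qed.

Let split_hi k : split (cast_ord (esym n12) (hi k)) = inr k.
Proof. by rewrite /hi cast_ordK (unsplitK (inr k)). Qed.

Lemma block_embed1_lo (x : kT) j : (phi x).1 (lo j) = lo (x.1.1 j).
Proof. by rewrite permE /block_ord split_lo. Qed.

Lemma block_embed1_hi (x : kT) k : (phi x).1 (hi k) = hi (x.2.1 k).
Proof. by rewrite permE /block_ord split_hi. Qed.

Lemma block_embed2_lo (x : kT) j : (phi x).2 (lo j) = x.1.2 j.
Proof. by rewrite ffunE split_lo. Qed.

Lemma block_embed2_hi (x : kT) k : (phi x).2 (hi k) = x.2.2 k.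
Proof. by rewrite ffunE split_hi. Qed.

Definition block_embedE := (block_embed1_lo, block_embed1_hi, block_embed2_lo, block_embed2_hi).

Lemma block_embedM : {morph phi : x y / (x * y)%g}.
Proof.
move=> x y; apply: signed_perm_eq => i; case: (blockP i) => j;
  by rewrite !signed_permE !block_embedE !signed_permE.
Qed.

Lemma block_embed_inj : injective phi.
Proof.
move=> [g h] [g' h'] e; congr (_, _); apply: signed_perm_eq => i; split.
- by apply: lo_inj; rewrite -(block_embed1_lo (g, h)) e block_embed1_lo.
- by rewrite -(block_embed2_lo (g, h)) e block_embed2_lo.
- by apply: hi_inj; rewrite -(block_embed1_hi (g, h)) e block_embed1_hi.
- by rewrite -(block_embed2_hi (g, h)) e block_embed2_hi.
Qed.

Lemma mem_block_embed (y : signed_perm n) :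
  (forall i, (n1 <= y.1 i)%N = (n1 <= i)%N) -> y \in phi @: setT.
Proof.
move=> y_block.
have /all_sig[s1 s1E] j : {j' | y.1 (lo j) = lo j'}.
  move: (y_block (lo j)); case: (blockP (y.1 (lo j))) => j'; first by exists j'.
  by rewrite leq_hi leq_lo.
have /all_sig[s2 s2E] k : {k' | y.1 (hi k) = hi k'}.
  move: (y_block (hi k)); case: (blockP (y.1 (hi k))) => k'; last by exists k'.
  by rewrite leq_hi leq_lo.
have inj1 : injective s1.
  by move=> i j e; apply/lo_inj/(@perm_inj _ y.1); rewrite !s1E e.
have inj2 : injective s2.
  by move=> i j e; apply/hi_inj/(@perm_inj _ y.1); rewrite !s2E e.
apply/imsetP; exists ((perm inj1, [ffun j => y.2 (lo j)]) : signed_perm n1,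
  (perm inj2, [ffun k => y.2 (hi k)]) : signed_perm n2) => //.
apply: signed_perm_eq => i; case: (blockP i) => j;
  by rewrite !block_embedE /= permE ffunE ?s1E ?s2E.
Qed.

Lemma sum_blocks (E : 'I_n -> nat) :
  (\sum_i E i = \sum_i E (lo i) + \sum_i E (hi i))%N.
Proof.
rewrite (reindex (cast_ord n12)) /=; last first.
  by exists (cast_ord (esym n12)) => i _; rewrite ?cast_ordK ?cast_ordKV.
by rewrite big_split_ord.
Qed.

Lemma sign_changes_block (x : kT) :
  sign_changes (phi x) = (sign_changes x.1 + sign_changes x.2)%N.
Proof.
rewrite !sign_changesE sum_blocks; congr (_ + _)%N; apply: eq_bigr => i _;
  by rewrite block_embedE.
Qed.

Definition sign_diag m (f : 'I_m -> bool) : signed_perm m := (1%g, finfun f).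

Lemma sign_diagJ (y : signed_perm n) f :
  (y * sign_diag f * y^-1)%g = sign_diag (fun i => f (y.1 i)).
Proof.
apply: signed_perm_eq => i; rewrite !signed_permE /= !ffunE !perm1 permK.
by split=> //; rewrite addbC addbA addbb.
Qed.

Lemma block_embed_diag f :
  phi (sign_diag (f \o lo), sign_diag (f \o hi)) = sign_diag f.
Proof.
by apply: signed_perm_eq => i; case: (blockP i) => j; rewrite !block_embedE /= !ffunE !perm1.
Qed.

Lemma bip_repr_diag (F : fieldType) f1 f2 :
  bip_repr F la (sign_diag f1, sign_diag f2) = ((-1) ^+ (\sum_i f2 i)%N)%:M.
Proof.
rewrite /= /bip_mx /= !(repr_mx1 (specht _ _)) tprod1 scalemx1 sign_changesE.
by congr ((-1) ^+ _)%:M; apply: eq_bigr => i _; rewrite ffunE.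
Qed.

Lemma sum_pred1_hi j : (\sum_k (hi k == j) = (n1 <= j))%N.
Proof.
case: (blockP j) => i; first by rewrite leq_lo big1 // => k _; rewrite hi_lo.
rewrite leq_hi (bigD1 i) //= eqxx big1 // => k ki.
by rewrite (inj_eq hi_inj) (negPf ki).
Qed.

(** The subgroup of sign changes distinguishes the cosets: if y does not
    preserve the blocks it moves some j to the other block, and the sign changes
    of the coordinates y j and j, which are conjugate by y, act by opposite
    scalars. *)
Lemma block_mackey (F : numFieldType) (y : signed_perm n) : y \notin phi @: setT ->
  exists x x' (a a' : F), [/\ x \in [set: kT], x' \in [set: kT],
    bip_repr F la x = a%:M, bip_repr F la x' = a'%:M
    & a != a' /\ (y * phi x * y^-1)%g = phi x'].
Proof.
move=> ny; have [j jy] : exists j, (n1 <= y.1 j)%N != (n1 <= j)%N.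
  apply/existsP; apply: contraR ny => /existsPn same.
  by apply: mem_block_embed => i; have := same i; rewrite negbK => /eqP.
pose f := [pred i | i == y.1 j].
exists (sign_diag (f \o lo), sign_diag (f \o hi)).
exists (sign_diag ((fun i => f (y.1 i)) \o lo), sign_diag ((fun i => f (y.1 i)) \o hi)).
exists ((-1) ^+ (n1 <= y.1 j)%N), ((-1) ^+ (n1 <= j)%N); split; rewrite ?inE //.
- by rewrite bip_repr_diag sum_pred1_hi.
- rewrite bip_repr_diag -sum_pred1_hi; congr ((-1) ^+ _)%:M.
  by apply: eq_bigr => k _ /=; rewrite (inj_eq perm_inj).
- by rewrite !block_embed_diag sign_diagJ (inj_eq signr_inj).
Qed.

End Blocks.

(** * Characters of symmetric bipartitions *)

Section SymmetricBipartition.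

Variables (F : numFieldType) (l : seq nat) (n : nat).
Variable n12 : (sumn (l, l).1 + sumn (l, l).2)%N = n.
Variables (d : nat) (rV : mx_representation F (Bn n) d).
Hypothesis indV : induced_along (block_embed n12) (bip_repr F (l, l)) rV.

Local Notation m := (sumn l).
Local Notation phi := (block_embed n12).
Local Notation lo := (lo n12).
Local Notation hi := (hi n12).
Local Notation E := (ext_char phi (bip_repr F (l, l))).

Let swap_fun (i : 'I_n) : 'I_n := match split (cast_ord (esym n12) i) with
  | inl j => hi j
  | inr k => lo k
  end.

Let swap_lo j : swap_fun (lo j) = hi j.
Proof. by rewrite /swap_fun cast_ordK (unsplitK (inl j)). Qed.

Let swap_hi k : swap_fun (hi k) = lo k.
Proof. by rewrite /swap_fun cast_ordK (unsplitK (inr k)). Qed.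

Let swap_inj : injective swap_fun.
Proof.
apply: (@can_inj _ _ _ swap_fun) => i.
by case: (blockP n12 i) => j; rewrite ?(swap_lo, swap_hi).
Qed.

Let swap : signed_perm n := (perm swap_inj, [ffun=> false]).

Let swapJ x : (swap * phi x * swap^-1)%g = phi (x.2, x.1).
Proof.
apply: (mulIg swap); rewrite mulgKV; apply: signed_perm_eq => i.
have swap1 k : swap.1 k = swap_fun k by rewrite permE.
have swap2 k : swap.2 k = false by rewrite ffunE.
rewrite !signed_permE !swap1 !swap2 addbF.
by case: (blockP n12 i) => j;
  rewrite ?(swap_lo, swap_hi) !block_embedE ?(swap_lo, swap_hi).
Qed.

Let phi_inj : {in [set: signed_perm m * signed_perm m] &, injective phi}.
Proof. by move=> x y _ _; apply: block_embed_inj. Qed.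

Let phiM : {in [set: signed_perm m * signed_perm m] &, {morph phi : x y / (x * y)%g}}.
Proof. by move=> x y _ _; apply: block_embedM. Qed.

Let u (s : 'S_m) : F := \tr (specht F l s).

Let bip_trace x : \tr (bip_repr F (l, l) x) = (-1) ^+ sign_changes x.2 * (u x.1.1 * u x.2.1).
Proof. by rewrite /= /bip_mx mxtraceZ mxtrace_prod. Qed.

(* The exchange of the blocks moves the sign-change character from one factor to
   the other, which is the same as a twist by the character of Bn with kernel
   Dn. *)
Let ext_char_swap g : E (swap * g * swap^-1)%g = (-1) ^+ sign_changes g * E g.
Proof.
have [|ng] := boolP (g \in phi @: setT).
  case/imsetP=> x _ ->; rewrite swapJ !ext_charE ?inE // !bip_trace /=.
  rewrite sign_changes_block exprD [u x.2.1 * _]mulrC !mulrA; congr (_ * _ * _).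
  by rewrite -mulrA -expr2 sqrr_sign mulr1.
rewrite !ext_char_out ?mulr0 //; apply: contra ng => /imsetP[[x1 x2] _ /(canRL (mulgK _))].
rewrite invgK => gE; apply/imsetP; exists (x2, x1) => //.
by apply: (mulgI swap); rewrite gE -(swapJ (x2, x1)) mulgKV.
Qed.

(** The induced character is invariant under the twist by the character of Bn
    with kernel Dn. *)
Lemma char_vanish g : odd (sign_changes g) -> \tr (rV g) = 0.
Proof.
move=> odd_g; have phiG : {in [set: signed_perm m * signed_perm m], forall x, phi x \in Bn n}.
  by move=> x _; rewrite inE.
have v_char := induced_char phiM phi_inj phiG indV (in_setT g).
apply/eqP; rewrite -(mulrI_eq0 _ (mulfI (natr_card_neq0 F [set: signed_perm m * signed_perm m]%G))).
have /eqP : #|[set: signed_perm m * signed_perm m]|%:R * \tr (rV g)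
  = - (#|[set: signed_perm m * signed_perm m]|%:R * \tr (rV g)).
  rewrite {1}v_char (reindex_inj (mulgI swap)) v_char -sumrN.
  apply: eq_big => [x|x _]; first by rewrite !inE.
  have -> : (swap * x * g * (swap * x)^-1 = swap * (x * g * x^-1) * swap^-1)%g.
    by rewrite invMg !mulgA.
  rewrite ext_char_swap -signr_odd !odd_sign_changesM odd_sign_changesV odd_g.
  by case: (odd (sign_changes x)); rewrite /= mulN1r.
by rewrite -addr_eq0 -mulr2n mulrn_eq0.
Qed.

(** The norm of the inducing representation is the square of the norm k of the
    Specht module, since both factors use the same partition. *)
Lemma char_norm_square : exists k : nat,
  \sum_(g in Bn n) \tr (rV g) * \tr (rV g^-1%g) = #|Bn n|%:R * (k ^ 2)%:R.
Proof.
pose K := [set: signed_perm m * signed_perm m]%G.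
have phiG : {in K, forall x, phi x \in Bn n} by move=> x _; rewrite inE.
have cardK0 := natr_card_neq0 F K.
exists (\rank (average (specht F l))); apply: (mulfI cardK0).
rewrite (induced_norm phiM phi_inj phiG indV cardK0) => [|y _ ny]; last first.
  exact: (@block_mackey (l, l) n n12 F y ny).
rewrite mulrCA; congr (_ * _).
pose A := \sum_(s : signed_perm m) u s.1 * u (s.1^-1)%g.
have -> : \sum_(x in K) \tr (bip_repr F (l, l) x) * \tr (bip_repr F (l, l) x^-1%g) = A * A.
  rewrite /A big_distrlr pair_bigA /=; apply: eq_big => [x|x _]; first by rewrite inE.
  rewrite !bip_trace -signr_odd -[(-1) ^+ sign_changes (x^-1)%g.2]signr_odd.
  rewrite [odd (sign_changes (x^-1)%g.2)]odd_sign_changesV mulrACA -signr_addb addbb mul1r.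
  by rewrite mulrACA.
have -> : A = #|[set: signed_perm m]|%:R * (\rank (average (specht F l)))%:R.
  rewrite /A -(pair_bigA _ (fun (s : 'S_m) (_ : {ffun 'I_m -> bool}) => u s * u s^-1%g)) /=.
  under eq_bigr do rewrite sumr_const -mulr_natl.
  rewrite -mulr_sumr (eq_bigl [in [set: 'S_m]]) => [|s]; last by rewrite !inE.
  rewrite char_norm mulrA; congr (_ * _).
  by rewrite -natrM !cardsT card_prod mulnC.
rewrite mulrACA natrX expr2; congr (_ * _).
by rewrite -natrM -cardsX; congr (_%:R); apply: eq_card => x; rewrite !inE.
Qed.

End SymmetricBipartition.

(** * Elliptic signed permutations *)

Lemma signed_permX1 n (g : signed_perm n) k i : (g ^+ k)%g.1 i = iter k g.1 i.
Proof.
elim: k => [|k IHk]; first by rewrite /= perm1.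
by rewrite expgSr signed_permM1 IHk.
Qed.

Lemma signed_permX2 n (g : signed_perm n) k i :
  (g ^+ k)%g.2 i = \big[addb/false]_(j < k) g.2 (iter j g.1 i).
Proof.
elim: k => [|k IHk]; first by rewrite big_ord0 /= ffunE.
by rewrite expgSr signed_permM2 IHk signed_permX1 big_ord_recr.
Qed.

Lemma odd_sign_changesE n (g : signed_perm n) :
  odd (sign_changes g) = \big[addb/false]_i g.2 i.
Proof.
rewrite sign_changesE (big_morph odd oddD (erefl _)).
by apply: eq_bigr => i _; case: (g.2 i).
Qed.

Section Elliptic.

Variables (F : numFieldType) (n : nat) (g : signed_perm n) (i0 : 'I_n).

Local Notation C := (porbit g.1 i0).

Lemma big_porbit : \big[addb/false]_(i in C) g.2 i
  = \big[addb/false]_(j < #|C|) g.2 (iter j g.1 i0).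
Proof.
rewrite (eq_bigl _ _ (porbit_traject g.1 i0)) -big_uniq ?uniq_traject_porbit //=.
rewrite (big_nth i0) size_traject big_mkord; apply: eq_bigr => j _.
by rewrite nth_traject.
Qed.

(** If the cycle of i0 carries an even number of sign changes, the sum of the
    vectors e_i0 g^j over one turn of the cycle is fixed by g, and its coordinate
    at i0 is 1. *)
Lemma positive_cycle_fixed :
  \big[addb/false]_(i in C) g.2 i = false -> \det (1%:M - sp_mx F g) = 0.
Proof.
rewrite big_porbit -signed_permX2 => posC.
pose v := \sum_(j < #|C|) row i0 (sp_mx F (g ^+ j)%g).
apply/eqP/det0P; exists v.
  apply/eqP=> /rowP/(_ i0)/eqP; rewrite summxE mxE.
  have C0 : (0 < #|C|)%N by rewrite lt0n card_porbit_neq0.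
  rewrite (bigD1 (Ordinal C0)) //= big1 => [|j j0].
    by rewrite !mxE /= ffunE perm1 eqxx mulr1 addr0 oner_eq0.
  rewrite !mxE signed_permX1; case: eqP => [ji|]; rewrite ?mulr0 //.
  have := uniq_traject_porbit g.1 i0 => /(nth_uniq i0).
  rewrite size_traject => /(_ j 0%N (ltn_ord j) C0).
  by rewrite !nth_traject //= ji eqxx => /esym/eqP j00; rewrite -val_eqE /= j00 in j0.
have rowS j : row i0 (sp_mx F (g ^+ j)%g) *m sp_mx F g = row i0 (sp_mx F (g ^+ j.+1)%g).
  by rewrite -row_mul expgSr; have [_ ->] := sp_mx_repr n F; rewrite ?inE.
rewrite mulmxBr mulmx1 mulmx_suml; under [X in _ - X]eq_bigr do rewrite rowS.
have row_period : row i0 (sp_mx F (g ^+ #|C|)%g) = row i0 (sp_mx F (g ^+ 0)%g).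
  by apply/rowP=> j; rewrite !mxE posC signed_permX1 iter_porbit /= ffunE perm1.
apply/eqP; rewrite subr_eq0; apply/eqP; move: row_period; rewrite /v.
case: #|C| => [|c] row_period; first by rewrite !big_ord0.
by rewrite big_ord_recl -row_period [RHS]big_ord_recr /= addrC.
Qed.

(** The cycle of g through i0, extended by the identity, commutes with g. If g is
    elliptic it carries an odd number of sign changes, so lies outside Dn. *)
Lemma elliptic_commute : \det (1%:M - sp_mx F g) != 0 ->
  exists2 x : signed_perm n, odd (sign_changes x) & (x * g = g * x)%g.
Proof.
move=> ell; have posC : \big[addb/false]_(i in C) g.2 i = true.
  by apply: contra_neqT ell => /negbTE/positive_cycle_fixed.
have stabC : g.1 \in 'N(C | 'P)%g.
  apply/astabsP=> i; rewrite /= /aperm.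
  by rewrite -!eq_porbit_mem -[g.1 i]/(iter 1 g.1 i) -permX porbit_perm.
have mem_g i : (g.1 i \in C) = (i \in C) by have /astabsP/(_ i) := stabC.
pose x : signed_perm n := (restr_perm C g.1, [ffun i => (i \in C) && g.2 i]).
have x_in i : i \in C -> x.1 i = g.1 i by move=> Ci; rewrite /= restr_permE.
have x_out i : i \notin C -> x.1 i = i by move=> Ci; rewrite /= (out_perm (restr_perm_on _ _)).
have x2 i : x.2 i = (i \in C) && g.2 i by rewrite ffunE.
exists x.
  have parity_x : \big[addb/false]_i x.2 i = \big[addb/false]_(i in C) g.2 i.
    by rewrite [RHS]big_mkcond; apply: eq_bigr => i _; rewrite x2; case: (i \in C).
  by rewrite odd_sign_changesE parity_x posC.
apply: signed_perm_eq => i; rewrite !signed_permM1 !signed_permM2 !x2 mem_g.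
have [Ci|nCi] := boolP (i \in C); first by rewrite !x_in ?mem_g //= addbC.
by rewrite !x_out ?mem_g //= addbF.
Qed.

End Elliptic.

(** * Type D *)

Section TypeD.

Variables (n : nat) (s : signed_perm n).
Hypothesis s_odd : odd (sign_changes s).

Lemma mem_Dn g : (g \in Dn n) = ~~ odd (sign_changes g).
Proof. by rewrite inE. Qed.

Lemma odd_sign_changesJ (g h : signed_perm n) :
  odd (sign_changes (g ^ h)%g) = odd (sign_changes g).
Proof.
by rewrite conjgE !odd_sign_changesM odd_sign_changesV addbCA addbb addbF.
Qed.

Lemma Dn_norm g : g \in 'N(Dn n).
Proof.
rewrite inE; apply/subsetP=> _ /imsetP[h Dh ->].
by rewrite mem_Dn odd_sign_changesJ -mem_Dn.
Qed.

Lemma Dn_coset2 : {in Bn n, forall b, b \notin Dn n -> (b * s^-1)%g \in Dn n}.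
Proof.
by move=> b _; rewrite !mem_Dn negbK odd_sign_changesM odd_sign_changesV s_odd => ->.
Qed.

Lemma card_Bn : #|Bn n| = (2 * #|Dn n|)%N.
Proof.
rewrite mul2n -addnn -{2}(card_rcoset (Dn n) s) -(cardsID (Dn n) (Bn n)) setTI.
congr (_ + _)%N; apply: eq_card => b; rewrite mem_rcoset !inE andbT odd_sign_changesM.
by rewrite odd_sign_changesV s_odd addbT.
Qed.

Variable F : numFieldType.

Lemma det_sp_mx_sqr (g : signed_perm n) : \det (sp_mx F g) ^+ 2 = 1.
Proof.
have -> : 1 = \det (sp_mx F g *m (sp_mx F g)^T).
  rewrite -[LHS](det1 F n); congr (\det _); apply/matrixP=> i j; rewrite !mxE.
  rewrite (bigD1 (g.1 i)) //= big1 => [|k /negbTE ki]; last first.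
    by rewrite !mxE eq_sym ki mulr0 mul0r.
  rewrite !mxE eqxx mulr1 addr0 (inj_eq perm_inj) eq_sym.
  by case: eqP => [->|_]; rewrite ?mulr0 // mulr1 -expr2 sqrr_sign.
by rewrite det_mulmx det_tr.
Qed.

(** In the general formula for a reflection the coefficient is half of 1 minus the
    eigenvalue lam; here lam = det r = -1, because a signed permutation matrix has
    determinant 1 or -1. *)
Lemma Dn_reflectionE (alpha : signed_perm n -> 'cV[F]_n)
    (alphav : signed_perm n -> 'rV[F]_n) :
  root_choice (Dn_refl n F) alpha alphav ->
  forall r, is_reflection (Dn_refl n F) r ->
    Dn_refl n F r = 1%:M - alpha r *m alphav r.
Proof.
move=> roots r refl_r; have [lam lam1 [ra rav pair2]] := roots r refl_r.
have [Dr /eqP rk1] := andP refl_r; pose R := Dn_refl n F r; pose A := R - 1%:M.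
have two0 : 2%:R != 0 :> F by rewrite pnatr_eq0.
have av0 : alphav r != 0.
  apply: contra_eqN pair2 => /eqP->; rewrite /pairing mul0mx mxE eq_sym.
  exact: two0.
have lam0 : lam != 0.
  apply: contraNneq av0 => lam0; have := rav; rewrite lam0 invr0 scale0r => rav0.
  by rewrite -[alphav r](repr_mxK (Dn_refl n F) (groupVr Dr)) rav0 mul0mx.
have avA : alphav r *m A = (lam - 1) *: alphav r.
  rewrite mulmxBr mulmx1 scalerBl scale1r; congr (_ - _).
  by rewrite -{1}(scalerKV lam0 (alphav r)) -rav -scalemxAl repr_mxKV.
have lam10 : lam - 1 != 0 by rewrite subr_eq0.
have /submxP[B AB] : (A <= alphav r)%MS.
  have le : (alphav r <= A)%MS.
    by rewrite -(scalerK lam10 (alphav r)) -avA scalemx_sub // submxMl.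
  by rewrite -(geq_leqif (mxrank_leqif_sup le)) rk1 lt0n mxrank_eq0.
have BE : 2%:R *: B = (lam - 1) *: alpha r.
  transitivity (A *m alpha r); last by rewrite mulmxBl mul1mx ra scalerBl scale1r.
  by rewrite AB -mulmxA [alphav r *m _]mx11_scalar -/(pairing _ _) pair2 mul_mx_scalar.
have RE : R = 1%:M + B *m alphav r by rewrite -AB addrC subrK.
have detR : \det R = lam.
  have adj1 : \adj (1%:M : 'M[F]_n) = 1%:M.
    by have := mul_mx_adj (1%:M : 'M[F]_n); rewrite mul1mx det1.
  rewrite RE det_add_rank1 det1 ?oner_neq0 // adj1 mulmx1; apply: (mulfI two0).
  have := congr1 (fun M : 'cV_n => (alphav r *m M) 0 0) BE.
  rewrite /= -!scalemxAr [LHS]mxE [RHS]mxE -/(pairing _ (alpha r)) pair2 => avB.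
  by rewrite mulrDr avB; ring.
have lamN1 : lam = -1.
  have /eqP := det_sp_mx_sqr r; rewrite -/(Dn_refl n F r) -/R detR sqrf_eq1.
  by rewrite (negbTE lam1) => /eqP.
rewrite -/R RE; congr (_ + _); rewrite -mulNmx; congr (_ *m _).
by apply: (scalerI two0); rewrite BE lamN1 scalerN -scaleNr; congr (_ *: _); ring.
Qed.

End TypeD.

Section TypeDFinite.

Variables (F : numClosedFieldType) (n : nat) (s : signed_perm n).
Hypothesis s_odd : odd (sign_changes s).

Lemma is_reflectionJ r g : is_reflection (Dn_refl n F) (r ^ g)%g = is_reflection (Dn_refl n F) r.
Proof.
rewrite /is_reflection memJ_norm ?Dn_norm //; congr (_ && (_ == _)).
have BnM := repr_mxM (Bn_refl n F); have Bnin x : x \in Bn n by rewrite inE.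
have -> : Dn_refl n F (r ^ g)%g - 1%:M
  = Bn_refl n F g^-1%g *m (Dn_refl n F r - 1%:M) *m Bn_refl n F g.
  rewrite mulmxBr mulmxBl mulmx1 -(BnM _ _ (Bnin _) (Bnin g)) mulVg repr_mx1.
  by rewrite -[Dn_refl n F r]/(Bn_refl n F r) -!BnM // -mulgA -conjgE.
rewrite mxrankMfree ?row_free_unit ?repr_mx_unit //.
by rewrite -mxrank_tr trmx_mul mxrankMfree ?mxrank_tr // row_free_unit unitmx_tr repr_mx_unit.
Qed.

Variables (c : F) (alpha : signed_perm n -> 'cV[F]_n) (alphav : signed_perm n -> 'rV[F]_n).
Hypothesis roots : root_choice (Dn_refl n F) alpha alphav.
Hypothesis n_gt0 : (0 < n)%N.
Variables (d : nat) (V : mx_representation F (Dn n) d).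
Hypothesis irrV : mx_irreducible V.
Hypothesis ortho_s : \sum_(g in Dn n) \tr (V g^-1%g) * \tr (V (g ^ s)%g) = 0.
Variable L : lmodType (cherednik (Dn_refl n F) (fun=> c) alpha alphav).

(** The trace formula is applied to the difference psi of the character of V and
    of its conjugate by s. It vanishes on the elliptic elements, so the left-hand
    side is 0, whereas the right-hand side is |Dn| by orthogonality. *)
Theorem Lc_infinite_dimensional : is_Lc V L -> ~ finite_dimensional L.
Proof.
case=> [[L_neq0 _] [f f_surj]] finL.
pose refl := is_reflection (Dn_refl n F).
have reflD r : refl r -> r \in Dn n by case/andP.
have absV := group_closure_closed_field irrV.
have [theta thetaE] : exists theta, \sum_(r | refl r) c *: V r^-1%g = theta%:M.
  apply/is_scalar_mxP/(mx_abs_irr_cent_scalar absV)/centgmxP=> g Dg.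
  rewrite mulmx_suml mulmx_sumr [RHS](reindex_inj (conjg_inj g)) /=.
  apply: eq_big => [r|r Rr]; first by rewrite /refl is_reflectionJ.
  have Dr := reflD r Rr; rewrite -scalemxAl -scalemxAr; congr (_ *: _).
  by rewrite -conjVg -!(repr_mxM V) ?groupJ ?groupV // -conjgC.
have [chi chiE] := elliptic_trace (Dn_reflectionE roots) thetaE f_surj irrV L_neq0 finL.
pose psi g := \tr (V g) - \tr (V (g ^ s)%g).
have psiS : {in Dn n, forall h, \sum_(r | refl r) c * psi (r^-1 * h)%g = theta * psi h}.
  have trS h : h \in Dn n -> \sum_(r | refl r) c * \tr (V (r^-1 * h)%g) = theta * \tr (V h).
    move=> Dh; rewrite -mxtraceZ -mul_scalar_mx -thetaE mulmx_suml raddf_sum /=.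
    apply: eq_bigr => r /reflD Dr.
    by rewrite (repr_mxM V) ?groupV // -scalemxAl mxtraceZ.
  move=> h Dh; rewrite /psi mulrBr -trS // -trS ?memJ_norm ?Dn_norm //.
  have -> : \sum_(r | refl r) c * \tr (V (r^-1 * h ^ s)%g)
    = \sum_(r | refl r) c * \tr (V ((r^-1 * h) ^ s)%g).
    rewrite (reindex_inj (conjg_inj s)) /=; apply: eq_big => [r|r _].
      by rewrite /refl is_reflectionJ.
    by rewrite -conjVg -conjMg.
  by rewrite -sumrB; apply: eq_bigr => r _; rewrite -mulrBr.
have := chiE psi psiS; rewrite big1 => [|g Dg].
  under eq_bigr do rewrite mulrBr.
  rewrite sumrB ortho_s subr0; under eq_bigr do rewrite mulrC.
  by rewrite char_irr_norm // => /esym/eqP; rewrite (negbTE (natr_card_neq0 F (Dn n))).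
have [->|ell] := eqVneq (\det (1%:M - Dn_refl n F g)) 0; first by rewrite !mul0r.
have [x x_odd xg] := elliptic_commute (Ordinal n_gt0) ell.
(* x is outside Dn, so conjugation by s agrees on g with conjugation by an element of Dn. *)
have Dxs : (x^-1 * s)%g \in Dn n.
  by rewrite mem_Dn odd_sign_changesM odd_sign_changesV x_odd s_odd.
suff -> : psi g = 0 by rewrite mulr0.
have -> : (psi g = \tr (V g) - \tr (V (g ^ (x^-1 * s))%g)).
  by rewrite /psi conjgM [(g ^ x^-1)%g]conjgE invgK mulgA xg mulgK.
by rewrite mxtrace_reprJ // subrr.
Qed.

End TypeDFinite.

Theorem theorem2p1
  (R : realType) (n : nat) (n_ge4 : (4 <= n)%N)
  (la : seq nat * seq nat) (bip : bipartition n la) (sym : la.1 = la.2)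
  (c : R[i])
  (alpha : signed_perm n -> 'cV[R[i]]_n) (alphav : signed_perm n -> 'rV[R[i]]_n)
  (roots : root_choice (Dn_refl n R[i]) alpha alphav)
  (d : nat) (Vla : mx_representation R[i] (Bn n) d) (isVla : is_Vla bip Vla)
  (dp : nat) (Vp : mx_representation R[i] (Dn n) dp)
  (dm : nat) (Vm : mx_representation R[i] (Dn n) dm)
  (splitting : Dn_splitting Vla Vp Vm)
  (Lp Lm : lmodType (cherednik (Dn_refl n R[i]) (fun=> c) alpha alphav))
  (isLp : is_Lc Vp Lp) (isLm : is_Lc Vm Lm) :
  ~ finite_dimensional Lp /\ ~ finite_dimensional Lm.
Proof.
have n_gt0 : (0 < n)%N by apply: leq_trans n_ge4.
case: la sym bip isVla => l l2 /= <- {l2} bip; rewrite /is_Vla => indV.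
have [irrVp irrVm simV] := splitting.
have [k normV] := char_norm_square indV.
pose s : signed_perm n := sign_diag (fun i => i == Ordinal n_gt0).
have s_odd : odd (sign_changes s).
  rewrite sign_changesE (bigD1 (Ordinal n_gt0)) // big1 => [|i /negbTE i0].
    by rewrite ffunE eqxx.
  by rewrite ffunE i0.
have trV0 : {in Bn n, forall g, g \notin Dn n -> \tr (Vla g) = 0}.
  by move=> g _; rewrite mem_Dn negbK => g_odd; rewrite (char_vanish indV g_odd).
have simV' := mx_rsim_trans simV (dadd_greprC _ _).
split.
  apply: (Lc_infinite_dimensional s_odd roots n_gt0 irrVp) isLp.
  exact: (conjg_char_ortho (in_setT s) (Dn_norm s) (Dn_coset2 s_odd) (card_Bn s_odd)
    irrVp irrVm simV trV0 normV).
apply: (Lc_infinite_dimensional s_odd roots n_gt0 irrVm) isLm.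
exact: (conjg_char_ortho (in_setT s) (Dn_norm s) (Dn_coset2 s_odd) (card_Bn s_odd)
    irrVm irrVp simV' trV0 normV).
Qed.
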